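(* (Neumann case.) Let $\Omega$ be a bounded domain of $\mathbb{R}^n$, $n\ge1$, let $0<\sigma_0<\sigma_1$ be constants, and let $\Sigma=\{\sigma\in L^\infty(\Omega):\ \sigma_0\le\sigma\le\sigma_1\text{ a.e. in }\Omega\}$. Set $\underline{\sigma}_0=\min(\sigma_0,1)$ and $\underline{\sigma}_1=\max(\sigma_1,1)$. For any $\sigma,\widetilde{\sigma}\in\Sigma$, $$\underline{\sigma}_0^2\,\|R^N_\sigma-R^N_{\widetilde{\sigma}}\|_{-1,1}\le\|\sigma-\widetilde{\sigma}\|_{L^\infty(\Omega)}\le\underline{\sigma}_1^2\,\|R^N_\sigma-R^N_{\widetilde{\sigma}}\|_{-1,1}.$$
   Context: Functions are real-valued. $H^1(\Omega)$ carries its usual norm $\|u\|_{H^1(\Omega)}=(\|\nabla u\|_{L^2(\Omega)^n}^2+\|u\|_{L^2(\Omega)}^2)^{1/2}$, $(H^1(\Omega))'$ is its dual with the dual norm, and $\langle\cdot,\cdot\rangle$ is the duality pairing between them. For $\sigma\in\Sigma$, $A^N_\sigma:H^1(\Omega)\to(H^1(\Omega))'$ is defined by $\langle A_\sigma^Nu,v\rangle=\int_\Omega\sigma\nabla u\cdot\nabla v\,dx+\int_\Omega uv\,dx$ for $u,v\in H^1(\Omega)$. It is bounded and invertible with bounded inverse $R_\sigma^N=(A_\sigma^N)^{-1}:(H^1(\Omega))'\to H^1(\Omega)$. Here $\|\cdot\|_{-1,1}$ denotes the operator norm in $\mathscr{B}((H^1(\Omega))',H^1(\Omega))$. *)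

(* Defs.v *)
From HB Require Import structures.
From mathcomp Require Import all_boot all_order all_algebra.
From mathcomp Require Import all_classical all_reals all_analysis.

Set Implicit Arguments.
Unset Strict Implicit.
Unset Printing Implicit Defensive.

Import Order.TTheory GRing.Theory Num.Theory.
Import numFieldNormedType.Exports.

Local Open Scope classical_set_scope.
Local Open Scope ring_scope.

Section measurable_rV.
Context {R : realType} (n : nat).

Let coor (i : 'I_n) (x : 'rV[R]_n) : measurableTypeR R := x 0 i.

Let rV_set0 : g_sigma_preimage coor set0.
Proof. exact: sigma_algebra0. Qed.

Let rV_setC A : g_sigma_preimage coor A -> g_sigma_preimage coor (~` A).
Proof. exact: sigma_algebraC. Qed.

Let rV_bigcup (F : (set 'rV[R]_n)^nat) :
  (forall i, g_sigma_preimage coor (F i)) ->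
  g_sigma_preimage coor (\bigcup_i (F i)).
Proof. exact: sigma_algebra_bigcup. Qed.

(* The product sigma-algebra on R^n, which is also the Borel one. *)
HB.instance Definition _ :=
  @isMeasurable.Build (measure_tuple_display default_measure_display)
    'rV[R]_n (g_sigma_preimage coor) rV_set0 rV_setC rV_bigcup.

Lemma measurable_rV_coor (i : 'I_n) : measurable_fun [set: 'rV[R]_n] (coor i).
Proof.
move=> _ Y mY; rewrite setTI; apply: sub_sigma_algebra => /=.
rewrite -bigcup_seq/=; exists i => /=; first by rewrite mem_index_enum.
by exists Y => //; rewrite setTI.
Qed.

Lemma measurable_fun_rV d (T : measurableType d) (f : T -> 'rV[R]_n) :
  (forall i, measurable_fun setT (coor i \o f)) -> measurable_fun setT f.
Proof.
move=> mf; apply: measurability; first by [].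
move=> _ [B BC <-]; rewrite setTI.
have [i [A mA <-]] : exists i, preimage_set_system setT (coor i) measurable B.
  by move: BC; rewrite -bigcup_seq => -[i _ ?]; exists i.
by rewrite setTI -comp_preimage -[X in measurable X]setTI; exact: mf.
Qed.

End measurable_rV.

Section lebesgue_rV.
Context {R : realType}.

Definition rV_cons n (p : measurableTypeR R * 'rV[R]_n) : 'rV[R]_n.+1 :=
  row_mx (p.1 : R)%:M p.2.

Definition rV_uncons n (x : 'rV[R]_n.+1) : measurableTypeR R * 'rV[R]_n :=
  (x 0 0, \row_i x 0 (lift 0 i)).

Lemma rV_consE n p i :
  @rV_cons n p 0 i = if unlift 0 i is Some j then p.2 0 j else p.1.
Proof.
rewrite mxE; case: unliftP => [j ->|->]; case: splitP => k.
- by case: k => -[].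
- by move=> [jk]; congr (p.2 _ _); exact/val_inj/esym.
- by rewrite mxE (ord1 k) eqxx.
- by [].
Qed.

Lemma rV_consK n : cancel (@rV_cons n) (@rV_uncons n).
Proof.
move=> p; rewrite /rV_uncons rV_consE unlift_none [RHS]surjective_pairing.
by congr (_, _); apply/rowP => i; rewrite mxE rV_consE liftK.
Qed.

Lemma measurable_rV_cons n : measurable_fun setT (@rV_cons n).
Proof.
apply: measurable_fun_rV => i.
rewrite (_ : _ \o _ = fun p : measurableTypeR R * 'rV[R]_n =>
  if unlift 0 i is Some j then p.2 0 j else p.1); last first.
  by apply/funext => p; rewrite /= rV_consE.
case: (unlift 0 i) => [j|]; last exact: measurable_fst.
exact: measurableT_comp (measurable_rV_coor j) measurable_snd.
Qed.

Lemma measurable_rV_uncons n : measurable_fun setT (@rV_uncons n).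
Proof.
apply: measurable_fun_pair; first exact: measurable_rV_coor.
apply: measurable_fun_rV => i.
rewrite (_ : _ \o _ = fun x : 'rV[R]_n.+1 => x 0 (lift 0 i) : measurableTypeR R).
  exact: measurable_rV_coor.
by apply/funext => x; rewrite /= mxE.
Qed.

Section step.
Context n (mu : {sigma_finite_measure set 'rV[R]_n -> \bar R}).

Definition lebesgue_rV_step : set 'rV[R]_n.+1 -> \bar R :=
  pushforward (lebesgue_measure \x mu)%E (@rV_cons n).

Let step_preimage A : measurable A -> measurable (@rV_cons n @^-1` A).
Proof.
by move=> mA; rewrite -[X in measurable X]setTI; exact: measurable_rV_cons.
Qed.

Let step0 : lebesgue_rV_step set0 = 0%E.
Proof. by rewrite /lebesgue_rV_step /pushforward preimage_set0 measure0. Qed.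

Let step_ge0 A : (0 <= lebesgue_rV_step A)%E.
Proof. by rewrite /lebesgue_rV_step /pushforward measure_ge0. Qed.

Let step_sigma_additive : semi_sigma_additive lebesgue_rV_step.
Proof.
move=> F mF tF mUF; rewrite /lebesgue_rV_step /pushforward preimage_bigcup.
apply: measure_semi_sigma_additive.
- by move=> k; exact: step_preimage.
- by apply/trivIsetP => i j _ _ ij; rewrite -preimage_setI;
    move/trivIsetP : tF => /(_ _ _ I I ij) ->; rewrite preimage_set0.
- by rewrite -preimage_bigcup; exact: step_preimage.
Qed.

HB.instance Definition _ := isMeasure.Build _ _ _ lebesgue_rV_step
  step0 step_ge0 step_sigma_additive.

Let step_sigma_finite : sigma_finite setT lebesgue_rV_step.
Proof.
have /sigma_finiteP[F [FT ndF Foo]] := sigma_finiteT (@lebesgue_measure R).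
have /sigma_finiteP[G [GT ndG Goo]] := sigma_finiteT mu.
exists (fun k => @rV_uncons n @^-1` (F k `*` G k)).
  rewrite -preimage_bigcup; apply/esym/seteqP; split=> // x _ /=.
  have : setT (rV_uncons x).1 by []; have : setT (rV_uncons x).2 by [].
  rewrite [X in X _.2 -> _]GT [X in _ -> X _.1 -> _]FT => -[l _ Gl] [m _ Fm].
  exists (maxn l m) => //; split.
    by move: Fm; exact/subsetPset/ndF/leq_maxr.
  by move: Gl; exact/subsetPset/ndG/leq_maxl.
move=> k; have [mF Fk] := Foo k; have [mG Gk] := Goo k; split.
  rewrite -[X in measurable X]setTI; apply: measurable_rV_uncons => //.
  exact: measurableX.
rewrite /lebesgue_rV_step /pushforward -comp_preimage.
rewrite (_ : _ \o _ = id) ?preimage_id; last first.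
  by apply/funext => p; exact: rV_consK.
by rewrite product_measure1E// lte_mul_pinfty// ge0_fin_numE.
Qed.

HB.instance Definition _ := Measure_isSigmaFinite.Build _ _ _ lebesgue_rV_step
  step_sigma_finite.

End step.

(* n-dimensional Lebesgue measure, as the n-fold product of the
   one-dimensional one (the point mass when n = 0). *)
Fixpoint lebesgue_rV n : {sigma_finite_measure set 'rV[R]_n -> \bar R} :=
  if n is m.+1 then lebesgue_rV_step (lebesgue_rV m) else \d_(0 : 'rV[R]_0).

End lebesgue_rV.

Section sobolev.
Context {R : realType} {n : nat}.
Implicit Types (Om : set 'rV[R]_n) (p : \bar R) (i : 'I_n).
Implicit Types u v g phi sigma : 'rV[R]_n -> R.

Local Notation mu := (@lebesgue_rV R n).

Definition domain Om := [/\ open Om, connected Om & Om !=set0].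

(* Functions on Om are represented by total functions that are only
   constrained on Om, and elements of L^p(Om) by measurable representatives;
   [u \_ Om] is the extension of u by zero outside Om. *)
Definition Lp_on Om p : set ('rV[R]_n -> R) :=
  [set u | (u \_ Om) \in Lfun mu p].

Definition Lp_norm Om p u : \bar R := Lnorm mu p (EFin \o (u \_ Om)).

Definition partial i phi : 'rV[R]_n -> R := 'D_(delta_mx 0 i) phi.

Definition smooth phi := forall s : seq 'I_n,
  let psi := foldr partial phi s in
  continuous psi /\ forall i x, derivable psi x (delta_mx 0 i).

Definition test_function Om : set ('rV[R]_n -> R) :=
  [set phi | let supp := closure [set x | phi x != 0] in
     [/\ smooth phi, compact supp & supp `<=` Om]].

Definition weak_partial Om i u g := forall phi, test_function Om phi ->
  \int[mu]_(x in Om) (u x * partial i phi x) =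
  - \int[mu]_(x in Om) (g x * phi x).

Definition H1 Om : set ('rV[R]_n -> R) :=
  [set u | Lp_on Om 2%:E u /\
     forall i, exists2 g, Lp_on Om 2%:E g & weak_partial Om i u g].

(* A representative of the i-th weak derivative, which is unique almost
   everywhere on Om. *)
Definition wpartial Om u i : 'rV[R]_n -> R :=
  xget (cst 0) [set g | Lp_on Om 2%:E g /\ weak_partial Om i u g].

Definition wgrad Om u (x : 'rV[R]_n) : 'rV[R]_n := \row_i wpartial Om u i x.

Definition dot (a b : 'rV[R]_n) : R := \sum_i a 0 i * b 0 i.

Definition H1_norm Om u : R :=
  Num.sqrt (\int[mu]_(x in Om) dot (wgrad Om u x) (wgrad Om u x)
            + \int[mu]_(x in Om) (u x ^+ 2)).

(* Bounded linear functionals on H^1(Om). Boundedness for the seminorm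
   [H1_norm] makes them independent of the choice of representatives. Their
   values outside of [H1 Om] are irrelevant. *)
Definition H1_dual Om : set (('rV[R]_n -> R) -> R) :=
  [set F | (forall (a : R) u v, H1 Om u -> H1 Om v ->
              F (a *: u + v) = a * F u + F v) /\
           (exists C : R, forall u, H1 Om u -> `|F u| <= C * H1_norm Om u)].

Definition H1_dual_norm Om (F : ('rV[R]_n -> R) -> R) : \bar R :=
  ereal_sup [set `|F u|%:E | u in [set u | H1 Om u /\ H1_norm Om u <= 1]].

(* Operator norm of T : (H^1(Om))' -> H^1(Om). *)
Definition norm_m1_1 Om (T : (('rV[R]_n -> R) -> R) -> 'rV[R]_n -> R) :
    \bar R :=
  ereal_sup [set (H1_norm Om (T F))%:E |
    F in [set F | H1_dual Om F /\ (H1_dual_norm Om F <= 1)%E]].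

Definition Sigma Om (s0 s1 : R) : set ('rV[R]_n -> R) :=
  [set sigma | Lp_on Om +oo%E sigma /\
     {ae mu, forall x, Om x -> s0 <= sigma x <= s1}].

Definition AN Om sigma u : ('rV[R]_n -> R) -> R := fun v =>
  \int[mu]_(x in Om) (sigma x * dot (wgrad Om u x) (wgrad Om v x))
  + \int[mu]_(x in Om) (u x * v x).

(* The inverse of [AN Om sigma], as a choice of a representative of the
   unique u in H^1(Om) such that [AN Om sigma u] and F agree on H^1(Om). *)
Definition RN Om sigma (F : ('rV[R]_n -> R) -> R) : 'rV[R]_n -> R :=
  xget (cst 0)
    [set u | H1 Om u /\ forall v, H1 Om v -> AN Om sigma u v = F v].

End sobolev.

(* Main.v *)
Require Import Defs.
From mathcomp Require Import all_boot all_order all_algebra.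
From mathcomp Require Import all_classical all_reals all_analysis.
From mathcomp Require Import measurable_realfun ess_sup_inf ring lra.

Set Implicit Arguments.
Unset Strict Implicit.
Unset Printing Implicit Defensive.

Import Order.TTheory GRing.Theory Num.Theory.
Import numFieldNormedType.Exports.

Local Open Scope classical_set_scope.
Local Open Scope ring_scope.

(** Write A and A' for the Neumann operators of two coefficients s and s', and
    R, R' for their inverses.  Everything follows from the resolvent identity
    A (R - R') F = (A' - A) R' F ([RN_difference]), in which A' - A is the form
    of (s' - s) grad u . grad v.

    Lower bound.  Test the identity with v = (R - R') F.  Both forms dominate
    m0 times the squared H^1 norm; this coercivity is used once for v and once
    to bound R' F, whence the factor m0 ^ 2 ([RN_difference_norm]).

    Upper bound.  Choose F = A' u.  The identity now expresses the quadratic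
    form of s - s' at u by R - R', so that it is at most m1 ^ 2 |R - R'| |u| ^ 2
    for every u in H^1 ([grad_form_RN_bound]).  A bound K |u| ^ 2 on this form
    forces |s - s'| <= K almost everywhere, because gradients can oscillate
    ([grad_form_bound_ae]): for a test function phi, the two waves
    phi cos (l x_0) / l and phi sin (l x_0) / l have squared gradients that add
    up to phi ^ 2 + |grad phi| ^ 2 / l ^ 2, while their L^2 norms are O(1 / l).
    Adding the two bounds and letting l tend to infinity gives
    |int (s - s') phi ^ 2| <= K int phi ^ 2, without any oscillatory integral,
    and density of the test functions in L^2 turns this into a pointwise bound
    ([weighted_ip_ge0_ae]).

    Since R is defined by choosing a solution, solutions must be shown to exist:
    the energy form is complete on H^1 ([complete_energy]), so the
    representation theorem [riesz] applies ([RNP]).  Weak derivatives are unique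
    only almost everywhere, by the fundamental lemma of the calculus of
    variations ([fundamental_lemma]), which makes all forms bilinear although
    the chosen representatives of the gradients need not be linear.

    Density is obtained without convolution.  The measurable sets A such that
    multiplication by the indicator of A preserves the L^2 closure of the test
    functions form a sigma-algebra ([cutoff_stable_measurable]); it contains the
    half-spaces, because the indicator of x_i > a is the limit of the smooth
    functions exp (- 1 / (k (x_i - a))), extended by 0.  That test functions belong to H^1 is
    integration by parts, proved by Fubini and the fundamental theorem of
    calculus on lines ([integral_partial]). *)

(** * Semi-inner products and the representation theorem *)

Lemma quadratic_discriminant (R : realFieldType) (a b c : R) : 0 <= a ->
  (forall t, 0 <= a * t ^+ 2 - 2 * b * t + c) -> b ^+ 2 <= a * c.
Proof.
move=> a0 H; have := H 0.
rewrite expr0n/= !mulr0 subr0 add0r => c0.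
move: a0; rewrite le_eqVlt => /predU1P[a0|a0].
  subst a; have [->|b0] := eqVneq b 0; first by rewrite expr0n mul0r.
  have := H ((c + 1) / (2 * b)).
  rewrite mul0r add0r (_ : 2 * b * _ = c + 1); first by lra.
  by field.
have := H (b / a).
rewrite (_ : _ + c = (a * c - b ^+ 2) / a); last by field; exact/lt0r_neq0.
by rewrite pmulr_lge0 ?invr_gt0// subr_ge0.
Qed.

(** Passage to the limit in an inequality whose error has geometric size. *)
Lemma ge0_of_geom (R : realType) (x D : R) :
  (forall k : nat, - (D * (2^-1) ^+ k) <= x) -> 0 <= x.
Proof.
move=> H; have h : - (D * (2^-1) ^+ k) @[k --> \oo] --> (0 : R).
  rewrite -oppr0 -(mulr0 D); apply: cvgN; apply: cvgMl_tmp.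
  by apply: cvg_expr; rewrite ger0_norm ?invr_ge0// invf_lt1// ltr1n.
rewrite -(cvg_lim _ h)//; apply: limr_le; first by apply/cvg_ex; exists 0.
by apply: nearW => k; exact: H.
Qed.

Section forms.
Context (R : realType) (V : lmodType R).
Implicit Types (S : set V) (b q : V -> V -> R) (F : V -> R).

Definition subspace_set S :=
  S 0 /\ forall (a : R) u v, S u -> S v -> S (a *: u + v).

Definition linear_form_on S F :=
  forall (a : R) u v, S u -> S v -> F (a *: u + v) = a * F u + F v.

Definition symmetric_form_on S b :=
  (forall u v, S u -> S v -> b u v = b v u) /\
  (forall w, S w -> linear_form_on S (b ^~ w)).

(** Completeness is only asked of sequences that are Cauchy at a geometric rate:
    minimizing sequences can be chosen so, and in L^2 such sequences converge
    almost everywhere without extracting a subsequence. *)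
Definition complete_form_on S b := forall (u : nat -> V) (C : R),
  (forall k, S (u k)) ->
  (forall k j, (k <= j)%N -> b (u j - u k) (u j - u k) <= C * (8^-1) ^+ k) ->
  exists v, S v /\ exists D : R,
    forall k, b (u k - v) (u k - v) <= D * (8^-1) ^+ k.

Section theory.
Variable S : set V.
Hypothesis Ssub : subspace_set S.

Lemma subspaceZ a u : S u -> S (a *: u).
Proof. by case: Ssub => S0 SL Su; rewrite -[_ *: _]addr0; exact: SL. Qed.

Lemma subspaceD u v : S u -> S v -> S (u + v).
Proof. by case: Ssub => S0 SL Su Sv; rewrite -[u]scale1r; exact: SL. Qed.

Lemma subspaceN u : S u -> S (- u).
Proof. by move=> Su; rewrite -scaleN1r; exact: subspaceZ. Qed.

Lemma subspaceB u v : S u -> S v -> S (u - v).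
Proof. by move=> Su Sv; apply: subspaceD => //; exact: subspaceN. Qed.

Section linear.
Variable F : V -> R.
Hypothesis FL : linear_form_on S F.

Lemma lformD u v : S u -> S v -> F (u + v) = F u + F v.
Proof. by move=> Su Sv; have := FL 1 Su Sv; rewrite scale1r mul1r. Qed.

Lemma lform0 : F 0 = 0.
Proof. by case: Ssub => S0 _; have /= := lformD S0 S0; rewrite addr0; lra. Qed.

Lemma lformZ a u : S u -> F (a *: u) = a * F u.
Proof.
by case: Ssub => S0 _ Su; have := FL a Su S0; rewrite addr0 lform0 addr0.
Qed.

Lemma lformN u : S u -> F (- u) = - F u.
Proof. by move=> Su; rewrite -scaleN1r lformZ// mulN1r. Qed.

Lemma lformB u v : S u -> S v -> F (u - v) = F u - F v.
Proof. by move=> Su Sv; rewrite lformD ?lformN//; exact: subspaceN. Qed.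

End linear.

Section bilinear.
Variable b : V -> V -> R.
Hypothesis bS : symmetric_form_on S b.

Lemma formC u v : S u -> S v -> b u v = b v u. Proof. exact: bS.1. Qed.

Lemma formDl u v w : S u -> S v -> S w -> b (u + v) w = b u w + b v w.
Proof. by move=> Su Sv Sw; exact: (lformD (bS.2 w Sw)). Qed.

Lemma form0 w : S w -> b 0 w = 0.
Proof. by move=> Sw; exact: (lform0 (bS.2 w Sw)). Qed.

Lemma formZl a u w : S u -> S w -> b (a *: u) w = a * b u w.
Proof. by move=> Su Sw; exact: (lformZ (bS.2 w Sw)). Qed.

Lemma formNl u w : S u -> S w -> b (- u) w = - b u w.
Proof. by move=> Su Sw; exact: (lformN (bS.2 w Sw)). Qed.

Lemma formBl u v w : S u -> S v -> S w -> b (u - v) w = b u w - b v w.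
Proof. by move=> Su Sv Sw; exact: (lformB (bS.2 w Sw)). Qed.

Lemma formDr u v w : S u -> S v -> S w -> b w (u + v) = b w u + b w v.
Proof.
move=> Su Sv Sw; rewrite formC//; last exact: subspaceD.
by rewrite formDl// (formC Su)// (formC Sv).
Qed.

Lemma formZr a u w : S u -> S w -> b w (a *: u) = a * b w u.
Proof.
by move=> Su Sw; rewrite formC//; [rewrite formZl// (formC Su)|exact: subspaceZ].
Qed.

Lemma formNr u w : S u -> S w -> b w (- u) = - b w u.
Proof. by move=> Su Sw; rewrite -scaleN1r formZr// mulN1r. Qed.

Lemma formBr u v w : S u -> S v -> S w -> b w (u - v) = b w u - b w v.
Proof. by move=> Su Sv Sw; rewrite formDr ?formNr//; exact: subspaceN. Qed.

Lemma form_sqr a u v : S u -> S v ->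
  b (u + a *: v) (u + a *: v) = b u u + 2 * a * b u v + a ^+ 2 * b v v.
Proof.
move=> Su Sv; have Sav := subspaceZ a Sv.
rewrite formDl ?formDr ?formZl ?formZr//; try exact: subspaceD.
by rewrite (formC Sv Su); ring.
Qed.

Lemma form_sqrB u v : S u -> S v ->
  b (u - v) (u - v) = b u u - 2 * b u v + b v v.
Proof. by move=> Su Sv; have := form_sqr (-1) Su Sv; rewrite scaleN1r => ->; ring. Qed.

Lemma form_sqrD u v : S u -> S v ->
  b (u + v) (u + v) = b u u + 2 * b u v + b v v.
Proof. by move=> Su Sv; have := form_sqr 1 Su Sv; rewrite scale1r => ->; ring. Qed.

Lemma form_sqrZ a u : S u -> b (a *: u) (a *: u) = a ^+ 2 * b u u.
Proof.
by move=> Su; rewrite formZl ?formZr//; [ring|exact: subspaceZ].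
Qed.

Lemma form_sqr_distC u v : S u -> S v -> b (u - v) (u - v) = b (v - u) (v - u).
Proof.
move=> Su Sv; rewrite -opprB formNl ?formNr ?opprK//; try exact: subspaceB.
by apply: subspaceN; exact: subspaceB.
Qed.

Lemma form_sqr_tri u v w : (forall u, S u -> 0 <= b u u) ->
  S u -> S v -> S w ->
  b (u - w) (u - w) <= 2 * b (u - v) (u - v) + 2 * b (v - w) (v - w).
Proof.
move=> b0 Su Sv Sw; have Suv := subspaceB Su Sv; have Svw := subspaceB Sv Sw.
have -> : u - w = (u - v) + (v - w) by rewrite addrA subrK.
rewrite form_sqrD//; have := b0 _ (subspaceB Suv Svw); rewrite form_sqrB//; lra.
Qed.

End bilinear.

(** Polarization bounds 4 t b u v by K times q (u + t v) + q (u - t v), for all t;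
    the discriminant of this quadratic polynomial in t is the claim. *)
Lemma form_dominated b q (K : R) :
  symmetric_form_on S b -> symmetric_form_on S q -> 0 <= K ->
  (forall u, S u -> 0 <= q u u) ->
  (forall u, S u -> `|b u u| <= K * q u u) ->
  forall u v, S u -> S v ->
    `|b u v| <= K * (Num.sqrt (q u u) * Num.sqrt (q v v)).
Proof.
move=> bS qS K0 q0 bq u v Su Sv.
rewrite -(@ler_pXn2r _ 2)// ?nnegrE ?mulr_ge0 ?sqrtr_ge0//.
rewrite real_normK ?num_real// !exprMn !sqr_sqrtr ?q0//.
have -> : K ^+ 2 * (q u u * q v v) = (K * q v v) * (K * q u u) by ring.
apply: quadratic_discriminant => [|t]; first by rewrite mulr_ge0// q0.
have Stv a := subspaceZ a Sv.
have := bq _ (subspaceD Su (Stv t)).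
have := bq _ (subspaceD Su (Stv (- t))).
rewrite !form_sqr// !ler_norml => /andP[h1 h2] /andP[h3 h4].
move: h1 h2 h3 h4; set B := b u v; lra.
Qed.

Lemma form_cs b : symmetric_form_on S b -> (forall u, S u -> 0 <= b u u) ->
  forall u v, S u -> S v ->
    `|b u v| <= Num.sqrt (b u u) * Num.sqrt (b v v).
Proof.
move=> bS b0 u v Su Sv; rewrite -[leRHS]mul1r.
apply: (form_dominated bS bS) => // w Sw.
by rewrite mul1r ger0_norm// b0.
Qed.

(** The solution minimizes J u = b u u - 2 F u.  By the parallelogram identity
    near-minimizers are close to each other, so a minimizing sequence converges;
    the first variation of J at the limit vanishes. *)
Lemma riesz b F : symmetric_form_on S b -> (forall u, S u -> 0 <= b u u) ->
  complete_form_on S b -> linear_form_on S F ->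
  (exists C, forall u, S u -> `|F u| <= C * Num.sqrt (b u u)) ->
  exists u, S u /\ forall v, S v -> b u v = F v.
Proof.
move=> bS b0 bC FL [C FC].
pose J u := b u u - 2 * F u.
have Jlb u : S u -> - C ^+ 2 <= J u.
  move=> Su; rewrite /J; have := FC _ Su; rewrite ler_norml => /andP[_ Fu].
  have := sqr_sqrtr (b0 _ Su); set s := Num.sqrt _ in Fu * => <-.
  by have := sqr_ge0 (s - C); nra.
pose E := [set J u | u in S].
have S0 := Ssub.1.
have Einf : has_inf E.
  by split; [exists (J 0), 0|exists (- C ^+ 2) => _ [u Su <-]; exact: Jlb].
have Jm u : S u -> inf E <= J u by move=> Su; apply: ge_inf => //; [case: Einf|exists u].
have ex k : exists u, S u /\ J u < inf E + (8^-1) ^+ k.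
  have [|_ [u Su <-] uk] := @inf_adherent _ E ((8^-1) ^+ k) _ Einf; last by exists u.
  by rewrite exprn_gt0// invr_gt0.
have /choice[u_ /all_and2[Su Ju]] := ex.
have JL u v t : S u -> S v ->
    J (u + t *: v) = J u + 2 * t * (b u v - F v) + t ^+ 2 * b v v.
  move=> Su' Sv; rewrite /J form_sqr// (lformD FL)// ?(lformZ FL)//; last exact: subspaceZ.
  ring.
have [||u [Su' [D uD]]] := bC u_ 4 => //.
  move=> k j kj.
  have Sd := subspaceB (Su j) (Su k).
  (* J at the midpoint of u_k and u_j is at least the infimum *)
  have h1 := JL (u_ k) _ (2^-1) (Su k) Sd.
  have h2 := JL (u_ k) _ 1 (Su k) Sd.
  rewrite scale1r subrKC in h2.
  have h3 := Jm _ (subspaceD (Su k) (subspaceZ (2^-1) Sd)).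
  rewrite {}h1 in h3.
  have h4 := Ju j; have h5 := Ju k.
  have h6 : 8^-1 ^+ j <= 8^-1 ^+ k :> R.
    by apply: ler_wiXn2l => //; rewrite ?invr_ge0// invf_le1// ler1n.
  move: h2 h3 h4 h5 h6; set X := b (_ - _) (_ - _); set Y := _ - F _.
  set e1 := _ ^+ j; set e2 := _ ^+ k; move=> h2 h3 h4 h5 h6.
  rewrite h2 in h4.
  move: h3 h4 h5 h6; lra.
exists u; split=> // v Sv.
suff h0 : (b u v - F v) ^+ 2 <= 0.
  by apply/eqP; rewrite -subr_eq0 -sqrf_eq0 eq_le sqr_ge0 h0.
rewrite -[leRHS](mulr0 (b v v)); apply: quadratic_discriminant => [|t]; first exact: b0.
pose s := - t.
suff : 0 <= 2 * s * (b u v - F v) + s ^+ 2 * b v v.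
  by rewrite /s sqrrN addr0 => H; rewrite (le_trans H)//; lra.
apply: (@ge0_of_geom _ _ (1 + `|s| * (D + b v v))) => k.
have Sd := subspaceB (Su k) Su'.
have h1 := Jm _ (subspaceD (Su k) (subspaceZ s Sv)).
rewrite JL// in h1.
have h2 := Ju k; have h3 := uD k.
set p := 2^-1 ^+ k.
have p0 : 0 < p by rewrite exprn_gt0.
have p1 : p <= 1 by rewrite exprn_ile1// invf_le1// ler1n.
have e8 : 8^-1 ^+ k = p ^+ 3 :> R.
  by rewrite -exprM mulnC exprM; congr (_ ^+ _); rewrite exprVn; congr (_^-1); ring.
rewrite e8 in h2 h3.
(* Young's inequality with weight p *)
have h4 : 2 * `|b (u_ k - u) v| * p <= b (u_ k - u) (u_ k - u) + p ^+ 2 * b v v.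
  have := b0 _ (subspaceD Sd (subspaceZ p Sv)).
  have := b0 _ (subspaceD Sd (subspaceZ (- p) Sv)).
  rewrite !form_sqr// => y1 y2.
  by have [_|_] := ger0P (b (u_ k - u) v); move: y1 y2; rewrite sqrrN; lra.
have h5 : b (u_ k - u) v = b (u_ k) v - b u v by rewrite formBl.
have h6 : 2 * `|b (u_ k - u) v| <= (D + b v v) * p.
  rewrite -(ler_pM2r p0) (le_trans h4)//.
  have D0 : 0 <= D * p ^+ 3 by rewrite (le_trans _ h3)// b0.
  have : 0 <= D by move: D0; rewrite pmulr_lge0// exprn_gt0.
  move: h3; set X := b (_ - _) (_ - _); nra.
have h7 : 2 * s * b (u_ k - u) v <= `|s| * (2 * `|b (u_ k - u) v|).
  rewrite mulrCA -normrM mulrAC -mulrA.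
  by rewrite ler_pM2l// mulrC ler_norm.
have h8 : `|s| * (2 * `|b (u_ k - u) v|) <= `|s| * ((D + b v v) * p).
  by rewrite ler_wpM2l.
have h9 : p ^+ 3 <= p by rewrite exprS ger_pMr// exprn_ile1// ltW.
have := le_trans h7 h8; rewrite h5; lra.
Qed.

End theory.
End forms.
(** * The space of square integrable functions *)
Section square_integrable.
Context d (T : measurableType d) (R : realType).
Variables (mu : {measure set T -> \bar R}) (D : set T).
Hypothesis mD : measurable D.
Implicit Types f g h s : T -> R.

Let intg f := mu.-integrable D (EFin \o f).

Lemma real_integrableD f g : intg f -> intg g -> intg (fun x => f x + g x).
Proof. by move=> fi gi; exact: (integrableD mD fi gi). Qed.

Lemma real_integrableZ k f : intg f -> intg (fun x => k * f x).
Proof. by move=> fi; exact: (integrableZl mD k fi). Qed.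

Lemma real_integrable_measurable f : intg f -> measurable_fun D f.
Proof. by move=> /integrableP[/measurable_EFinP]. Qed.

Lemma ae_eq_Rintegral f g : measurable_fun D f -> measurable_fun D g ->
  {ae mu, forall x, D x -> f x = g x} ->
  \int[mu]_(x in D) f x = \int[mu]_(x in D) g x.
Proof.
move=> mf mg fg; congr fine; apply: ae_eq_integral => //; try exact/measurable_EFinP.
by apply: filterS fg => x /[swap] Dx -> //.
Qed.

Lemma ae_dominated_integrable f g : measurable_fun D f -> intg g ->
  {ae mu, forall x, D x -> `|f x| <= g x} -> intg f.
Proof.
move=> mf gi fg; have mg := real_integrable_measurable gi.
apply/integrableP; split; first exact/measurable_EFinP.
case/integrableP : gi => _; apply: le_lt_trans; apply: ae_ge0_le_integral => //.
- by apply: measurableT_comp => //; exact/measurable_EFinP.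
- by apply: measurableT_comp => //; exact/measurable_EFinP.
- apply: filterS fg => x fg Dx; rewrite /= lee_fin (le_trans (fg Dx))//.
  exact: ler_norm.
Qed.

Lemma ae_le_Rintegral f g : intg f -> intg g ->
  {ae mu, forall x, D x -> f x <= g x} ->
  \int[mu]_(x in D) f x <= \int[mu]_(x in D) g x.
Proof.
move=> fi gi fg; have mf := real_integrable_measurable fi; have mg := real_integrable_measurable gi.
rewrite -subr_ge0 -RintegralB//.
rewrite (@ae_eq_Rintegral _ (fun x => `|g x - f x|)).
- by apply: Rintegral_ge0.
- exact: measurable_funB.
- by apply: measurableT_comp => //; exact: measurable_funB.
- by apply: filterS fg => x fg Dx; rewrite ger0_norm// subr_ge0 fg.
Qed.

Lemma Rintegral_sum (I : Type) (r : seq I) (F : I -> T -> R) :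
  (forall i, intg (F i)) ->
  intg (fun x => \sum_(i <- r) F i x) /\
  \int[mu]_(x in D) (\sum_(i <- r) F i x) =
  \sum_(i <- r) \int[mu]_(x in D) F i x.
Proof.
move=> iF; elim: r => [|a r [IHi IH]].
  under [in X in _ /\ X]eq_Rintegral do rewrite big_nil.
  rewrite big_nil Rintegral_cst// mul0r; split=> //.
  rewrite /intg (_ : EFin \o _ = cst 0%E); first exact: integrable0.
  by apply/funext => x /=; rewrite big_nil.
have E x : \sum_(i <- a :: r) F i x = F a x + \sum_(i <- r) F i x by rewrite big_cons.
split; first by under eq_fun do rewrite E; exact: real_integrableD.
transitivity (\int[mu]_(x in D) (F a x + \sum_(i <- r) F i x)).
  by apply: eq_Rintegral => x _; rewrite E.
by rewrite (RintegralD mD (iF a) IHi) IH big_cons.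
Qed.

Definition sq_integrable : set (T -> R) :=
  [set f : T -> R | measurable_fun D f /\ intg (fun x => f x ^+ 2)].

Definition ess_bounded : set (T -> R) :=
  [set s : T -> R | measurable_fun D s /\
    exists C, {ae mu, forall x, D x -> `|s x| <= C}].

(** The inner product of L^2 with a density [s] that need not be nonnegative. *)
Definition weighted_ip s f g := \int[mu]_(x in D) (s x * (f x * g x)).

Lemma sq_integrableM f g : sq_integrable f -> sq_integrable g -> intg (fun x => f x * g x).
Proof.
move=> [mf fi] [mg gi]; apply: (ae_dominated_integrable _ (real_integrableD fi gi)).
  exact: measurable_funM.
apply: aeW => x Dx; rewrite ler_norml.
have := sqr_ge0 (f x - g x); have := sqr_ge0 (f x + g x).
have := sqr_ge0 (f x); have := sqr_ge0 (g x).
by rewrite sqrrD sqrrB => ? ? ? ?; apply/andP; split; lra.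
Qed.

Lemma ess_bounded_integrable s h : ess_bounded s -> intg h -> intg (fun x => s x * h x).
Proof.
move=> [ms [C sC]] hi; have mh := real_integrable_measurable hi.
apply: (@ae_dominated_integrable _ (fun x => C * `|h x|)).
- exact: measurable_funM.
- apply: real_integrableZ; exact: (integrable_norm hi).
- by apply: filterS sC => x sC Dx; rewrite normrM ler_wpM2r// sC.
Qed.

Lemma ess_bounded_cst k : ess_bounded (cst k).
Proof. by split=> //; exists `|k|; exact: aeW. Qed.

Lemma ess_boundedB s t : ess_bounded s -> ess_bounded t ->
  ess_bounded (fun x => s x - t x).
Proof.
move=> [ms [C sC]] [mt [C' tC]]; split; first exact: measurable_funB.
exists (C + C'); apply: filterS2 sC tC => x sC tC Dx.
by rewrite (le_trans (ler_normB _ _))// lerD// ?sC// tC.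
Qed.

Lemma subspace_sq_integrable : subspace_set sq_integrable.
Proof.
split=> [|a f g [mf fi] [mg gi]].
  split; first exact: measurable_cst.
  rewrite /intg (_ : EFin \o _ = cst 0%E); last first.
    by apply/funext => x /=; rewrite expr0n.
  exact: integrable0.
have ma : measurable_fun D (a *: f) by apply: measurable_funM => //.
split; first exact: measurable_funD.
have aif : sq_integrable (a *: f).
  split=> //.
  rewrite (_ : (fun _ => _) = (fun x => a ^+ 2 * f x ^+ 2)); first exact: real_integrableZ.
  by apply/funext => x; rewrite -exprMn.
have h := sq_integrableM aif (conj mg gi).
have := real_integrableD (real_integrableD aif.2 gi) (real_integrableZ 2 h); congr (mu.-integrable _ _).
by apply/funext => x /=; rewrite sqrrD mulr_natl addrAC.
Qed.

Lemma weighted_ip_integrable s f g : ess_bounded s -> sq_integrable f -> sq_integrable g ->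
  intg (fun x => s x * (f x * g x)).
Proof. by move=> sb fs gs; apply: ess_bounded_integrable => //; exact: sq_integrableM. Qed.

Lemma symmetric_weighted_ip s : ess_bounded s -> symmetric_form_on sq_integrable (weighted_ip s).
Proof.
move=> sb; split=> [f g fs gs|h hs a f g fs gs].
  by apply: eq_Rintegral => x _; rewrite (mulrC (f x)).
rewrite /weighted_ip -RintegralZl//; last exact: weighted_ip_integrable.
rewrite -RintegralD//; last 2 first.
  by apply: real_integrableZ; exact: weighted_ip_integrable.
  exact: weighted_ip_integrable.
by apply: eq_Rintegral => x _; rewrite !fctE /=; rewrite /GRing.scale/=; ring.
Qed.

Lemma weighted_ip_le s t f : ess_bounded s -> ess_bounded t -> sq_integrable f ->
  {ae mu, forall x, D x -> s x <= t x} -> weighted_ip s f f <= weighted_ip t f f.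
Proof.
move=> sb tb fs st; apply: ae_le_Rintegral; try exact: weighted_ip_integrable.
by apply: filterS st => x st Dx; rewrite ler_wpM2r ?st// -expr2 sqr_ge0.
Qed.

Lemma weighted_ipB s t f g : ess_bounded s -> ess_bounded t -> sq_integrable f -> sq_integrable g ->
  weighted_ip (fun x => s x - t x) f g = weighted_ip s f g - weighted_ip t f g.
Proof.
move=> sb tb fs gs; rewrite /weighted_ip -RintegralB//; try exact: weighted_ip_integrable.
by apply: eq_Rintegral => x _; rewrite mulrBl.
Qed.

Lemma weighted_ipZ k s f g : ess_bounded s -> sq_integrable f -> sq_integrable g ->
  weighted_ip (fun x => k * s x) f g = k * weighted_ip s f g.
Proof.
move=> sb fs gs; rewrite /weighted_ip -RintegralZl//; last exact: weighted_ip_integrable.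
by apply: eq_Rintegral => x _; rewrite -mulrA.
Qed.

Lemma ae_eq_weighted_ip s f f' g g' : ess_bounded s -> sq_integrable f -> sq_integrable f' ->
  sq_integrable g -> sq_integrable g' ->
  {ae mu, forall x, D x -> f x = f' x} ->
  {ae mu, forall x, D x -> g x = g' x} ->
  weighted_ip s f g = weighted_ip s f' g'.
Proof.
move=> sb [mf _] [mf' _] [mg _] [mg' _] ff' gg'; have [ms _] := sb.
apply: ae_eq_Rintegral; try by do 2 apply: measurable_funM => //.
by apply: filterS2 ff' gg' => x ff' gg' Dx; rewrite ff'// gg'.
Qed.

Definition l2_ip := weighted_ip (cst 1).

Lemma l2_ipE f g : l2_ip f g = \int[mu]_(x in D) (f x * g x).
Proof. by apply: eq_Rintegral => x _; rewrite mul1r. Qed.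

Lemma symmetric_l2_ip : symmetric_form_on sq_integrable l2_ip.
Proof. exact/symmetric_weighted_ip/ess_bounded_cst. Qed.

Lemma l2_ip_ge0 f : 0 <= l2_ip f f.
Proof. by rewrite l2_ipE; apply: Rintegral_ge0 => x _; rewrite -expr2 sqr_ge0. Qed.

Lemma EFin_l2_ip f : sq_integrable f ->
  (l2_ip f f)%:E = (\int[mu]_(x in D) (f x ^+ 2)%:E)%E.
Proof.
move=> [mf fi]; rewrite l2_ipE /Rintegral fineK.
  by apply: eq_integral => x _; rewrite expr2.
rewrite (eq_integral (fun x => (f x ^+ 2)%:E)) => [|x _]; last by rewrite expr2.
exact: integrable_fin_num.
Qed.

(** With d_k = u_(k+1) - u_k, the integral of G = sum_k 4 ^ k d_k ^ 2 is finite.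
    Where G is finite, |d_k| <= sqrt G / 2 ^ k, so u_k converges pointwise; Fatou's
    lemma bounds the L^2 distance from u_k to the limit. *)
Lemma complete_l2_ip : complete_form_on sq_integrable l2_ip.
Proof.
move=> u C us uC.
have C0 : 0 <= C.
  by have := uC 0%N 0%N (leqnn _); rewrite expr0 mulr1; apply: le_trans; exact: l2_ip_ge0.
pose h k x : R := 4 ^+ k * (u k.+1 x - u k x) ^+ 2.
have us2 j k : sq_integrable (fun x => u j x - u k x) := subspaceB subspace_sq_integrable (us j) (us k).
have mh k : measurable_fun D (h k).
  by apply: measurable_funM => //; apply: measurable_funX; exact: (us2 _ _).1.
have h0 k x : 0 <= h k x by apply: mulr_ge0; [exact: exprn_ge0|exact: sqr_ge0].
pose G x := (\sum_(0 <= k <oo) (h k x)%:E)%E.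
have mG : measurable_fun D G.
  by apply: ge0_emeasurable_sum => [k x _ _|k _]; [rewrite lee_fin|exact/measurable_EFinP].
have G0 x : (0 <= G x)%E by apply: nneseries_ge0 => k _ _; rewrite lee_fin.
have ih k : (\int[mu]_(x in D) (h k x)%:E <= (2 * C / (2 ^ (k + 1))%:R)%:E)%E.
  have -> : (\int[mu]_(x in D) (h k x)%:E = (4 ^+ k * l2_ip (u k.+1 - u k) (u k.+1 - u k))%:E)%E.
    rewrite EFinM EFin_l2_ip; last exact: us2.
    rewrite -ge0_integralZl//.
    - by apply/measurable_EFinP; apply: measurable_funX; exact: (us2 _ _).1.
    - by move=> x _; rewrite lee_fin sqr_ge0.
  rewrite lee_fin (le_trans (ler_wpM2l _ (uC _ _ (leqnSn k))))// ?exprn_ge0//.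
  rewrite mulrCA -exprMn (_ : 4 * 8^-1 = 2^-1 :> R); last by field.
  have p0 : (2 : R) ^+ k != 0 by rewrite expf_neq0.
  rewrite natrX exprD expr1 exprVn le_eqVlt; apply/orP; left; apply/eqP.
  by field.
have Gi : mu.-integrable D G.
  apply/integrableP; split=> //.
  rewrite (eq_integral G) => [|x _]; last by rewrite gee0_abs.
  have mhE k : measurable_fun D (EFin \o h k) by exact/measurable_EFinP.
  have hE0 k x : D x -> (0 <= (EFin \o h k) x)%E by rewrite lee_fin.
  rewrite (integral_nneseries mu mD mhE hE0).
  apply: (@le_lt_trans _ _ (2 * C / 2 ^+ 0)%:E); last exact: ltry.
  have cv := @cvg_geometric_eseries_half R (2 * C) 0.
  rewrite -(cvg_lim _ cv)//; apply: lee_nneseries => k _.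
    by move=> _; apply: integral_ge0 => x /hE0.
  exact: ih.
have Gfin := integrable_ae mD Gi.
pose A := D `&` [set x | G x \is a fin_num].
have mA : measurable A by exact: emeasurable_fin_num.
have cvgu x : A x -> cvgn (u ^~ x).
  move=> [Dx Gx]; have -> : u ^~ x = cst (u 0%N x) \+ series (telescope (u ^~ x)).
    by apply/funext => k; rewrite /= [LHS](eq_sum_telescope (u ^~ x)).
  apply: is_cvgD; first exact: is_cvg_cst.
  apply: normed_cvg.
  apply: (@series_le_cvg _ _ (geometric (Num.sqrt (fine (G x))) (2^-1))) => //.
  - by move=> k; exact: normr_ge0.
  - by move=> k; rewrite /geometric/= mulr_ge0 ?sqrtr_ge0// exprn_ge0.
  - move=> k; rewrite /geometric /= /telescope /=.
    have hG : h k x <= fine (G x).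
      rewrite -lee_fin fineK//.
      apply: (le_trans _ (nneseries_lim_ge k.+1 _)) => [|i _ _]; last by rewrite lee_fin.
      by rewrite big_nat_recr//= leeDr// sume_ge0// => i _; rewrite lee_fin.
    rewrite -(@ler_pXn2r _ 2)// ?nnegrE ?mulr_ge0 ?sqrtr_ge0// ?exprn_ge0//.
    rewrite real_normK ?num_real// exprMn sqr_sqrtr; last exact: fine_ge0.
    have -> : (2^-1 ^+ k) ^+ 2 = (4 ^+ k)^-1 :> R.
      by rewrite -exprM mulnC exprM -exprVn; congr (_ ^+ _); field.
    by rewrite ler_pdivlMr ?exprn_gt0// mulrC.
  - by apply: is_cvg_geometric_series; rewrite ger0_norm// invf_lt1// ltr1n.
pose f := (fun x => limn (u ^~ x)) \_ A.
pose v k := u k \_ A.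
have AD : A `<=` D by move=> x [].
have mv k : measurable_fun D (v k).
  apply/measurable_restrict => //; rewrite setIidr//.
  exact: measurable_funS (us k).1.
have vf x : v ^~ x @ \oo --> f x.
  rewrite /v /f /patch; case: ifPn => xA; last exact: cvg_cst.
  by apply: cvgu; exact: set_mem.
have mf : measurable_fun D f by apply: (measurable_fun_cvg mv) => x _; exact: vf.
have aev k : {ae mu, forall x, D x -> v k x = u k x}.
  apply: filterS Gfin => x Gx Dx; rewrite /v /patch mem_set//.
  by split => //=; exact: Gx.
have fat k : (\int[mu]_(x in D) ((f x - u k x) ^+ 2)%:E <= (C * 8^-1 ^+ k)%:E)%E.
  pose w j x := ((v (j + k)%N x - u k x) ^+ 2)%:E.
  have mw j : measurable_fun D (w j).
    apply/measurable_EFinP; apply: measurable_funX; apply: measurable_funB => //.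
    exact: (us k).1.
  have w0 j x : (0 <= w j x)%E by rewrite lee_fin sqr_ge0.
  have := fatou mu mD mw (fun j x _ => w0 j x).
  rewrite (eq_integral (fun x => ((f x - u k x) ^+ 2)%:E)) => [|x _]; last first.
    have wc : w ^~ x @ \oo --> ((f x - u k x) ^+ 2)%:E.
      apply: cvg_EFin; first exact: nearW.
      apply: (@cvg_comp _ _ _ (fun j => v (j + k)%N x - u k x) (fun y => y ^+ 2)
        _ _ _ _ (@exprn_continuous R 2 _)).
      apply: cvgB; last exact: cvg_cst.
      by have := vf x; rewrite -(cvg_shiftn k).
    by rewrite is_cvg_limn_einfE; [exact/cvg_lim|apply/cvg_ex; eexists; exact: wc].
  move=> /le_trans; apply; apply: (le_trans (limn_einf_sup _)).
  rewrite limn_esup_lim; apply: lime_le; first exact: is_cvg_esups.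
  apply: nearW => m; apply: ge_ereal_sup => _ [j _ <-].
  rewrite (ae_eq_integral (fun x => ((u (j + k)%N x - u k x) ^+ 2)%:E))//.
  - rewrite -EFin_l2_ip; last exact: us2.
    by rewrite lee_fin uC// leq_addl.
  - by apply/measurable_EFinP; apply: measurable_funX; exact: (us2 _ _).1.
  - by apply: filterS (aev (j + k)%N) => x vE Dx; rewrite /w vE.
have fus k : sq_integrable (fun x => f x - u k x).
  have mfu : measurable_fun D (fun x => f x - u k x).
    by apply: measurable_funB => //; exact: (us k).1.
  split=> //; apply/integrableP; split.
    by apply/measurable_EFinP; exact: measurable_funX.
  apply: le_lt_trans (ltry (C * 8^-1 ^+ k)).
  rewrite (eq_integral (fun x => ((f x - u k x) ^+ 2)%:E)) => [|x _]; first exact: fat.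
  by rewrite /= ger0_norm// sqr_ge0.
have fs : sq_integrable f.
  have := subspaceD subspace_sq_integrable (fus 0%N) (us 0%N).
  by congr sq_integrable; apply/funext => x; rewrite !fctE subrK.
exists f; split => //; exists C => k.
rewrite (form_sqr_distC subspace_sq_integrable symmetric_l2_ip)//.
rewrite -lee_fin EFin_l2_ip; first exact: fat.
exact: fus.
Qed.

End square_integrable.
(** * Borel sets and integration of partial derivatives in R^n *)
Section rational_boxes.
Context (R : realType) (n : nat).
Implicit Types (U : set 'rV[R]_n) (q : 'rV[rat]_n * rat).

Definition rat_box q : set 'rV[R]_n :=
  [set x | forall i, `|x 0 i - ratr (q.1 0 i)| < ratr q.2].

Definition rat_cbox q : set 'rV[R]_n :=
  [set x | forall i, `|x 0 i - ratr (q.1 0 i)| <= ratr q.2].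

(** Both the measurability of open sets and the reduction of almost everywhere
    properties to test functions rest on this countable cover. *)
Lemma open_rat_box U x : open U -> U x ->
  exists q, rat_box q x /\ rat_cbox q `<=` U.
Proof.
move=> oU Ux; have /nbhs_ballP[e /= e0 eU] : nbhs x U by exact: open_nbhs_nbhs.
have [r] : exists r : rat, (ratr r : R) \in `]0, (e / 2)[.
  by apply: rat_in_itvoo; rewrite divr_gt0.
rewrite in_itv/= => /andP[r0 re].
have ex i : exists q : rat, `|x 0 i - ratr q| < ratr r.
  have [|q] := @rat_in_itvoo R (x 0 i - ratr r) (x 0 i + ratr r).
    by rewrite ltrBlDr -addrA ltrDl addr_gt0.
  rewrite in_itv/= => /andP[q1 q2]; exists q.
  by rewrite ltr_norml; apply/andP; split; lra.
have [q qx] := choice ex.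
exists (\row_i q i, r); split=> [i /=|y yq]; first by rewrite mxE.
apply: eU; split=> // i j; rewrite (ord1 i) /ball/=.
have := yq j; rewrite mxE /= => yj; have := qx j => xj.
rewrite (_ : _ - _ = (x 0 j - ratr (q j)) - (y 0 j - ratr (q j))); last by ring.
by rewrite (le_lt_trans (ler_normB _ _))//; lra.
Qed.

Lemma measurable_coord (i : 'I_n) : measurable_fun setT (fun x : 'rV[R]_n => x 0 i).
Proof. exact: measurable_rV_coor. Qed.

Lemma measurable_coords (P : 'I_n -> R -> bool) :
  (forall i, measurable [set t | P i t]) ->
  measurable [set x : 'rV[R]_n | forall i, P i (x 0 i)].
Proof.
move=> mP; rewrite (_ : mkset _ =
    \bigcap_(i in [set: 'I_n]) ((fun x : 'rV[R]_n => x 0 i) @^-1` [set t | P i t])).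
  apply: fin_bigcap_measurable => [|i _]; first exact: finite_finset.
  by rewrite -[X in measurable X]setTI; exact: measurable_coord.
by apply/seteqP; split=> [x Px i _|x Px i]; [exact: Px|exact: (Px i I)].
Qed.

Lemma measurable_rat_box q : measurable (rat_box q).
Proof.
apply: (@measurable_coords (fun i t => `|t - ratr (q.1 0 i)| < ratr q.2)) => i.
rewrite (_ : mkset _ = ball (ratr (q.1 0 i) : R) (ratr q.2)); first exact: measurable_ball.
by apply/seteqP; split=> t; rewrite /ball/= distrC.
Qed.

Lemma open_measurable_rV U : open U -> measurable U.
Proof.
move=> oU; rewrite (_ : U = \bigcup_q
    (if `[< rat_cbox q `<=` U >] then rat_box q else set0)).
  apply: countable_bigcupT_measurable => [|q]; first exact: countableP.
  by case: ifP => // _; exact: measurable_rat_box.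
apply/seteqP; split=> [x Ux|x [q _]].
  by have [q [qx qU]] := open_rat_box oU Ux; exists q => //; rewrite asboolT.
case: ifPn => // /asboolP qU xq; apply: qU => i; exact/ltW/xq.
Qed.

Lemma continuous_measurable_rV (f : 'rV[R]_n -> R) :
  continuous f -> measurable_fun setT f.
Proof.
move=> /continuousP cf; apply: (measurability _ (RGenOpens.measurableE R)).
move=> _ [_ [a [b ->] <-]]; rewrite setTI.
by apply: open_measurable_rV; exact/cf/interval_open.
Qed.

End rational_boxes.

Section bounded_support.
Context d (T : measurableType d) (R : realType).
Variable mu : {measure set T -> \bar R}.

Lemma integrable_bounded_support (A : set T) (f : T -> R) (C : R) :
  measurable A -> (mu A < +oo)%E -> measurable_fun setT f ->
  (forall x, `|f x| <= C) -> (forall x, ~ A x -> f x = 0) ->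
  mu.-integrable setT (EFin \o f).
Proof.
move=> mA muA mf fC f0; apply/integrableP; split; first exact/measurable_EFinP.
rewrite (_ : (fun _ => _) = (EFin \o (fun x => `|f x|)) \_ A); last first.
  apply/funext => x; rewrite /patch; case: ifPn => //.
  by rewrite notin_setE => /f0 /= ->; rewrite normr0.
rewrite -integral_mkcond (@le_lt_trans _ _ (\int[mu]_(x in A) (`|C|)%:E)%E)//.
  apply: ge0_le_integral => //.
  - by move=> x _; rewrite lee_fin.
  - apply/measurable_EFinP; apply: measurableT_comp => //.
    exact: measurable_funTS.
  - by move=> x _; rewrite lee_fin (le_trans (fC x))// ler_norm.
by rewrite integral_cst// lte_mul_pinfty// lee_fin.
Qed.

End bounded_support.

Section integral_partial.
Context (R : realType).

(** A directional derivative depends only on the restriction of the function to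
    a line, so it can be moved between spaces of different dimensions. *)
Lemma is_derive_line (V V' : normedModType R) (f : V -> R) (f' : V' -> R)
    (a v : V) (a' v' : V') (l : R) :
  (forall h, f (h *: v + a) = f' (h *: v' + a')) ->
  is_derive a v f l -> is_derive a' v' f' l.
Proof.
move=> ff' [df fl].
have E : (fun h : R => h^-1 *: ((f' \o shift a') (h *: v') - f' a')) =
         (fun h : R => h^-1 *: ((f \o shift a) (h *: v) - f a)).
  apply/funext => h /=; rewrite ff'; congr (_ *: (_ - _)).
  by have := ff' 0; rewrite !scale0r !add0r.
by split; [rewrite /derivable E|rewrite /derive E].
Qed.

Lemma integral_derive_line (F G : R -> R) (M : R) :
  continuous G -> (forall t : R, is_derive t 1 F (G t)) ->
  (forall t, M < `|t| -> F t = 0 /\ G t = 0) ->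
  (\int[lebesgue_measure]_t (G t)%:E)%E = 0%E.
Proof.
move=> cG dF FG0; pose b := `|M| + 1.
have Mb : M < b by rewrite (le_lt_trans (ler_norm _))// ltrDl.
have b0 : 0 < b by rewrite ltr_wpDl.
have cF : continuous F.
  by move=> t; apply/differentiable_continuous/derivable1_diffP; case: (dF t).
transitivity (\int[lebesgue_measure]_(t in `[(- b)%R, b]) (G t)%:E)%E.
  rewrite [RHS]integral_mkcond; apply: eq_integral => t _.
  rewrite /patch; case: ifPn => //; rewrite notin_setE /= in_itv/= -ler_norml.
  by move=> /negP; rewrite -ltNge => bt; rewrite (FG0 t _).2// (lt_trans Mb).
rewrite (@continuous_FTC2 _ G F).
- have [Fb _] : F b = 0 /\ G b = 0 by apply: FG0; rewrite gtr0_norm.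
  have [FNb _] : F (- b) = 0 /\ G (- b) = 0 by apply: FG0; rewrite normrN gtr0_norm.
  by rewrite Fb FNb sube0.
- by rewrite gtrN.
- exact: continuous_subspaceT.
- split=> [t _| |].
  + by case: (dF t).
  + by apply: cvg_at_right_filter; exact: cF.
  + by apply: cvg_at_left_filter; exact: cF.
- by move=> t _; rewrite derive1E; case: (dF t).
Qed.


Definition cube n (M : R) : set 'rV[R]_n := [set x | forall i, `|x 0 i| <= M].

Lemma measurable_cube n M : measurable (@cube n M).
Proof.
apply: (@measurable_coords R n (fun _ t => `|t| <= M)) => _.
rewrite (_ : mkset _ = `[- M, M]%classic); first exact: measurable_itv.
by apply/seteqP; split=> t; rewrite /= in_itv/= ler_norml.
Qed.

Lemma rV_cons_cube n M :
  @rV_cons R n @^-1` cube M = `[- M, M]%classic `*` cube M.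
Proof.
apply/seteqP; split=> [p pM|p [p1 p2] i].
  split=> [|i]; first by have := pM 0; rewrite rV_consE unlift_none /= in_itv/= ler_norml.
  by have := pM (lift 0 i); rewrite rV_consE liftK.
rewrite rV_consE; case: unliftP => [j _|_]; first exact: p2.
by move: p1; rewrite /= in_itv/= ler_norml.
Qed.

Lemma lebesgue_rV_cube_lty n M : (lebesgue_rV n (@cube n M) < +oo)%E.
Proof.
elim: n => [|n IH]; first by rewrite /= diracE ltry.
rewrite /= /lebesgue_rV_step /pushforward rV_cons_cube product_measure1E//.
  by rewrite lte_mul_pinfty ?ge0_fin_numE//= lebesgue_measure_itv/=; case: ifP => //; rewrite -?EFinD ltry.
exact: measurable_cube.
Qed.

Lemma integrable_cube n (f : 'rV[R]_n -> R) C M : measurable_fun setT f ->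
  (forall x, `|f x| <= C) -> (forall x, ~ cube M x -> f x = 0) ->
  (lebesgue_rV n).-integrable setT (EFin \o f).
Proof.
move=> mf fC f0; apply: (integrable_bounded_support _ _ mf fC f0).
- exact: measurable_cube.
- exact: lebesgue_rV_cube_lty.
Qed.

Lemma continuous_rV_consl n (y : 'rV[R]_n) :
  continuous (fun t : R => rV_cons (t, y)).
Proof.
move=> t A /nbhs_ballP[e e0 eA]; apply/nbhs_ballP; exists e => // s ts.
apply: eA; split=> // i j; rewrite (ord1 i) !rV_consE.
by case: unliftP => [k _|_] /=; [exact: ballxx|exact: ts].
Qed.

Lemma continuous_rV_consr n (t : R) :
  continuous (fun y : 'rV[R]_n => rV_cons (t, y)).
Proof.
move=> y A /nbhs_ballP[e e0 eA]; apply/nbhs_ballP; exists e => // z [_ yz].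
apply: eA; split=> // i j; rewrite (ord1 i) !rV_consE.
by case: unliftP => [k _|_] /=; [exact: yz|exact: ballxx].
Qed.

Lemma rV_cons_line0 n (h t : R) (y : 'rV[R]_n) :
  h *: delta_mx 0 0 + rV_cons (t, y) = rV_cons (h *: (1 : R) + t, y).
Proof.
apply/rowP => i; rewrite mxE rV_consE mxE mxE rV_consE.
case: (unliftP 0 i) => [k ->|->] /=; first by rewrite mulr0 add0r.
by [].
Qed.

Lemma rV_cons_lineS n (h t : R) (j : 'I_n) (y : 'rV[R]_n) :
  h *: delta_mx 0 (lift 0 j) + rV_cons (t, y) =
  rV_cons (t, h *: delta_mx 0 j + y).
Proof.
apply/rowP => i; rewrite mxE rV_consE mxE mxE rV_consE.
case: (unliftP 0 i) => [k ->|->] /=; last by rewrite mulr0 add0r.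
by rewrite !mxE (inj_eq lift_inj).
Qed.

(** Induction on the dimension: split off the first coordinate by Fubini.  If the
    derivative is taken along it, the inner integral vanishes by the fundamental
    theorem of calculus; otherwise the induction hypothesis applies to slices. *)
Lemma integral_partial n (i : 'I_n) (f g : 'rV[R]_n -> R) (C M : R) :
  continuous g -> (forall x, is_derive x (delta_mx 0 i) f (g x)) ->
  (forall x, `|g x| <= C) ->
  (forall x, ~ cube M x -> f x = 0 /\ g x = 0) ->
  (\int[lebesgue_rV n]_x (g x)%:E)%E = 0%E.
Proof.
elim: n i f g => [[]//|n IH] i f g cg dfg gC fg0.
have mg : measurable_fun setT g by exact: continuous_measurable_rV.
have mgc : measurable_fun setT (g \o @rV_cons R n).
  by apply: measurableT_comp => //; exact: measurable_rV_cons.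
have igc : (lebesgue_measure \x lebesgue_rV n)%E.-integrable setT
    (EFin \o (g \o @rV_cons R n)).
  apply: (@integrable_bounded_support _ _ _ _ (@rV_cons R n @^-1` cube M) _ C) => //.
  - rewrite -[X in measurable X]setTI; apply: measurable_rV_cons => //.
    exact: measurable_cube.
  - exact: (lebesgue_rV_cube_lty n.+1 M).
  - by move=> p; exact: gC.
  - by move=> p /fg0[].
have mgE : measurable_fun setT (EFin \o g) by exact/measurable_EFinP.
rewrite [LHS](integral_pushforward (@measurable_rV_cons R n) mgE)//.
rewrite preimage_setT.
have [i0|[j ij]] : i = 0 \/ exists j, i = lift 0 j.
  by case: (unliftP 0 i) => [j ->|->]; [right; exists j|left].

- rewrite -(integral21_prod_meas1 igc) integral0_eq// => y _.
  apply: (@integral_derive_line (fun t => f (rV_cons (t, y)))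
    (fun t => g (rV_cons (t, y))) M).
  + move=> t; apply: (@continuous_comp _ _ _ (fun t => rV_cons (t, y)) g).
      exact: continuous_rV_consl.
    exact: cg.
  + move=> t; move: (dfg (rV_cons (t, y))); apply: is_derive_line => h.
    by rewrite i0 rV_cons_line0.
  + move=> t Mt; apply: fg0 => /(_ 0).
    by rewrite rV_consE unlift_none /= leNgt Mt.
- rewrite -(integral12_prod_meas1 igc) integral0_eq// => t _.
  apply: (IH j (fun y => f (rV_cons (t, y))) (fun y => g (rV_cons (t, y)))).
  + move=> y; apply: (@continuous_comp _ _ _ (fun y => rV_cons (t, y)) g).
      exact: continuous_rV_consr.
    exact: cg.
  + move=> y; move: (dfg (rV_cons (t, y))); apply: is_derive_line => h.
    by rewrite ij rV_cons_lineS.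
  + by move=> y; exact: gC.
  + move=> y yM; apply: fg0 => H; apply: yM => k.
    by have := H (lift 0 k); rewrite rV_consE liftK.
Qed.

End integral_partial.

(** * Smooth functions *)
Section flat_function.
Context (R : realType).
Implicit Types (k : nat) (t : R).

(** The factor t ^ - k makes the family closed under differentiation, up to linear
    combinations. *)
Definition flat k t : R := if 0 < t then t^-1 ^+ k * expR (- t^-1) else 0.

Lemma flat_le0 k t : t <= 0 -> flat k t = 0.
Proof. by move=> t0; rewrite /flat ltNge t0. Qed.

Lemma flat_gt0 k t : 0 < t -> 0 < flat k t.
Proof. by move=> t0; rewrite /flat t0 mulr_gt0 ?expR_gt0// exprn_gt0// invr_gt0. Qed.

Lemma flat_ge0 k t : 0 <= flat k t.
Proof. by rewrite /flat; case: ifP => // t0; rewrite mulr_ge0 ?expR_ge0// exprn_ge0// invr_ge0 ltW. Qed.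

Lemma flat0_le1 t : flat 0 t <= 1.
Proof.
rewrite /flat; case: ifP => // t0; rewrite expr0 mul1r -expR0 ler_expR oppr_le0.
by rewrite invr_ge0 ltW.
Qed.

(** From y ^ (k + 2) / (k + 2)! <= exp y at y = 1 / t; a bound of order 2 gives
    differentiability at 0. *)
Lemma flat_le_sqr k t : flat k t <= k.+2`!%:R * t ^+ 2.
Proof.
rewrite /flat; case: ifP => t0; last by rewrite mulr_ge0// sqr_ge0.
have y0 : 0 < t^-1 by rewrite invr_gt0.
have := expR_ge1Dxn k.+1 (ltW y0); rewrite expRN => h.
rewrite ler_pdivrMr ?expR_gt0//.
have h' : t^-1 ^+ k.+2 <= k.+2`!%:R * expR t^-1.
  rewrite mulrC -ler_pdivrMr ?ltr0n ?fact_gt0//; apply: le_trans h.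
  by rewrite ler_wpDl.
rewrite mulrAC -ler_pdivrMr ?exprn_gt0//; apply: le_trans h'.
by rewrite -exprVn -exprD addn2.
Qed.

Lemma is_derive_flat k t :
  is_derive t 1 (flat k) (- k%:R * flat k.+1 t + flat k.+2 t).
Proof.
have [t0|t0|<-{t}] := ltgtP 0 t.
- have D : is_derive t 1 (fun s => s^-1 ^+ k * expR (- s^-1))
     (- k%:R * flat k.+1 t + flat k.+2 t).
    have tn0 : t != 0 by rewrite gt_eqF.
    have dV : is_derive t 1 (fun s : R => s^-1) (- t ^- 2).
      have := @is_deriveV R id t 1 1 tn0 (is_derive_id _ _).
      by rewrite [_ *: _]mulr1.
    have dX := is_deriveX k dV.
    have dE : is_derive t 1 (fun s : R => expR (- s^-1)) (expR (- t^-1) * t ^- 2).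
      have dN : is_derive t 1 (fun s : R => - s^-1) (t ^- 2).
        by have := is_deriveN dV; rewrite opprK.
      exact: (is_derive1_comp (is_derive_expR _) dN).
    have := is_deriveM dX dE.
    rewrite (_ : _ * _ = (fun s => s^-1 ^+ k * expR (- s^-1))); last first.
      by apply/funext => s; rewrite !fctE.
    move=> D; apply: (is_derive_eq D); rewrite /flat t0 !fctE /GRing.scale/=.
    case: k {dX D} => [|k]; rewrite ?exprS ?expr0 /=; field => //.
  move: D; apply: near_eq_is_derive.
  near=> s; rewrite /flat ifT//; near: s; exact: lt_nbhsr.
- rewrite !flat_le0 ?ltW// mulr0 addr0.
  have := is_derive_cst (0 : R) t (1 : R); apply: near_eq_is_derive.
  near=> s; rewrite /= flat_le0// ltW//; near: s; exact: lt_nbhsl.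
- rewrite !flat_le0// mulr0 addr0.
  have L : h^-1 *: ((flat k \o shift 0) (h *: (1 : R)) - flat k 0) @[h --> 0^'] --> (0 : R).
    apply/cvgrPdist_le => e e0; near=> h.
    rewrite sub0r normrN /= addr0 [h *: 1]mulr1 (flat_le0 k (lexx 0)) subr0.
    rewrite [_ *: _]/(_ * _) normrM (ger0_norm (flat_ge0 _ _)).
    have h0 : h != 0 by near: h; exact: nbhs_dnbhs_neq.
    rewrite normfV mulrC ler_pdivrMr ?normr_gt0//.
    rewrite (le_trans (flat_le_sqr _ _))// -(@real_normK _ h) ?num_real// expr2 mulrA.
    rewrite ler_wpM2r// mulrC -ler_pdivlMr ?ltr0n ?fact_gt0//.
    near: h; apply: dnbhs0_le; rewrite divr_gt0// ltr0n fact_gt0//.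
  by split; [apply/cvg_ex; exists 0|exact/cvg_lim].
Unshelve. all: by end_near. Qed.

(** The smooth functions t |-> flat 0 (j t) approximate the indicator function of
    the positive half-line. *)
Lemma cvg_flat0 t : 0 < t -> flat 0 (j%:R * t) @[j --> \oo] --> (1 : R).
Proof.
move=> t0; have L : - (j%:R * t)^-1 @[j --> \oo] --> (0 : R).
  apply/cvgrPdist_le => e e0; near=> j.
  have jt : (e * t)^-1 <= j%:R by near: j; exact: nbhs_infty_ger.
  have j0 : 0 < j%:R :> R by rewrite (lt_le_trans _ jt)// invr_gt0 mulr_gt0.
  rewrite sub0r opprK ger0_norm; last by rewrite invr_ge0 mulr_ge0 ?ltW.
  move: jt; rewrite -[_^-1]div1r -[(_ * t)^-1 in X in _ -> X]div1r !ler_pdivrMr ?mulr_gt0// => jt.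
  by rewrite mulrCA.
have : expR (- (j%:R * t)^-1) @[j --> \oo] --> expR 0.
  by apply: (cvg_comp _ _ L); exact: continuous_expR.
rewrite expR0; apply: cvg_trans; apply: near_eq_cvg; near=> j.
rewrite /flat ifT; first by rewrite expr0 mul1r.
rewrite mulr_gt0// ltr0n; near: j; exact: nbhs_infty_gt.
Unshelve. all: by end_near. Qed.

End flat_function.

Section elementary.
Context (R : realType) (n : nat).
Implicit Types (f g : 'rV[R]_n -> R).

(** Smoothness as iterated differentiability is inconvenient for products.  This
    algebra contains the cutoffs and the oscillating functions that are needed,
    and an induction shows that it is stable under partial derivatives. *)
Inductive elementary : ('rV[R]_n -> R) -> Prop :=
| elem_cst c : elementary (fun=> c)
| elem_flat k c d (i : 'I_n) : elementary (fun x => flat k (c * x 0 i + d))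
| elem_cos c (i : 'I_n) : elementary (fun x => cos (c * x 0 i))
| elem_sin c (i : 'I_n) : elementary (fun x => sin (c * x 0 i))
| elem_add f g : elementary f -> elementary g -> elementary (fun x => f x + g x)
| elem_mul f g : elementary f -> elementary g -> elementary (fun x => f x * g x).

Lemma elementary_prod (I : Type) (r : seq I) (F : I -> 'rV[R]_n -> R) :
  (forall i, elementary (F i)) -> elementary (fun x => \prod_(i <- r) F i x).
Proof.
move=> eF; elim: r => [|a r IH].
  by under eq_fun do rewrite big_nil; exact: elem_cst.
by under eq_fun do rewrite big_cons; exact: elem_mul.
Qed.

Lemma is_derive_coord (phi dphi : R -> R) (i j : 'I_n) (x : 'rV[R]_n) :
  is_derive (x 0 i) 1 phi (dphi (x 0 i)) ->
  is_derive x (delta_mx 0 j) (fun y : 'rV[R]_n => phi (y 0 i))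
    ((i == j)%:R * dphi (x 0 i)).
Proof.
have [<-|ij] := eqVneq i j.
  rewrite mul1r; apply: is_derive_line => h.
  by rewrite !mxE !eqxx.
move=> _; rewrite mul0r.
have := is_derive_cst (phi (x 0 i)) x (delta_mx 0 j : 'rV[R]_n).
apply: is_derive_line => h.
by rewrite !mxE (negbTE ij) andbF mulr0 add0r.
Qed.

Lemma is_derive_affine (c d t : R) : is_derive t 1 (fun s => c * s + d) c.
Proof.
have dc := is_deriveZ c (is_derive_id t (1 : R)).
have := is_deriveD dc (is_derive_cst d t (1 : R)).
by rewrite addr0 [_ *: _]mulr1.
Qed.

Lemma is_derive_coord_affine (phi : R -> R) (l c d : R) (i j : 'I_n) (x : 'rV[R]_n) :
  is_derive (c * x 0 i + d) 1 phi l ->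
  is_derive x (delta_mx 0 j) (fun y : 'rV[R]_n => phi (c * y 0 i + d))
    ((i == j)%:R * c * l).
Proof.
move=> dphi; rewrite -mulrA.
have dA := is_derive_affine c d (x 0 i).
have dC : is_derive (x 0 i) 1 (fun t => phi (c * t + d)) (c * l).
  by rewrite [c * l]mulrC; exact: (@is_derive1_comp R phi (fun t => c * t + d) (x 0 i) l c).
exact: (@is_derive_coord _ (fun=> c * l) _ _ _ dC).
Qed.

Lemma elementary_partial f (i : 'I_n) : elementary f ->
  exists g, elementary g /\ forall x, is_derive x (delta_mx 0 i) f (g x).
Proof.
elim=> [c|k c d j|c j|c j|{}f g _ [f' [ef df]] _ [g' [eg dg]]|{}f g ef0 [f' [ef df]] eg0 [g' [eg dg]]].
- by exists (fun=> 0); split=> [|x]; [exact: elem_cst|exact: is_derive_cst].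
- exists (fun x => (j == i)%:R * c *
    (- k%:R * flat k.+1 (c * x 0 j + d) + flat k.+2 (c * x 0 j + d))); split.
    apply: elem_mul; first exact: elem_cst.
    apply: elem_add; last exact: elem_flat.
    by apply: elem_mul; [exact: elem_cst|exact: elem_flat].
  by move=> x; apply: is_derive_coord_affine; exact: is_derive_flat.
- exists (fun x => (j == i)%:R * c * (- 1 * sin (c * x 0 j))); split.
    apply: elem_mul; first exact: elem_cst.
    by apply: elem_mul; [exact: elem_cst|exact: elem_sin].
  move=> x; have := @is_derive_coord_affine cos (- 1 * sin (c * x 0 j)) c 0 j i x.
  under eq_fun do rewrite addr0; rewrite addr0; apply.
  by rewrite mulN1r; exact: is_derive_cos.
- exists (fun x => (j == i)%:R * c * cos (c * x 0 j)); split.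
    by apply: elem_mul; [exact: elem_cst|exact: elem_cos].
  move=> x; have := @is_derive_coord_affine sin (cos (c * x 0 j)) c 0 j i x.
  by under eq_fun do rewrite addr0; rewrite addr0; apply.
- exists (fun x => f' x + g' x); split=> [|x]; first exact: elem_add.
  exact: (is_deriveD (df x) (dg x)).
- exists (fun x => f x * g' x + g x * f' x); split=> [|x].
    by apply: elem_add; exact: elem_mul.
  exact: (is_deriveM (df x) (dg x)).
Qed.

Lemma continuous_coord_affine (phi : R -> R) (c d : R) (i : 'I_n) : continuous phi ->
  continuous (fun x : 'rV[R]_n => phi (c * x 0 i + d)).
Proof.
move=> cphi x.
apply: (@continuous_comp _ _ _ (fun x : 'rV[R]_n => x 0 i) (fun t => phi (c * t + d))).
  exact: coord_continuous.
apply: (@continuous_comp _ _ _ (fun t : R => c * t + d) phi); last exact: cphi.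
apply/differentiable_continuous/derivable1_diffP.
by case: (is_derive_affine c d (x 0 i)).
Qed.

Lemma elementary_continuous f : elementary f -> continuous f.
Proof.
elim=> [c|k c d j|c j|c j|{}f g _ cf _ cg|{}f g _ cf _ cg].
- exact: cst_continuous.
- apply: continuous_coord_affine => t; apply/differentiable_continuous/derivable1_diffP.
  by case: (is_derive_flat k t).
- have := @continuous_coord_affine cos c 0 j (@continuous_cos R).
  by under eq_fun do rewrite addr0.
- have := @continuous_coord_affine sin c 0 j (@continuous_sin R).
  by under eq_fun do rewrite addr0.
- by move=> x; exact: (continuousD (cf x) (cg x)).
- by move=> x; exact: (continuousM (cf x) (cg x)).
Qed.

(** Iterated partial derivatives stay in the algebra. *)
Lemma elementary_smooth f : elementary f -> smooth f.
Proof.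
move=> ef s; suff es : elementary (foldr (@partial R n) f s).
  split=> [|i x]; first exact: elementary_continuous.
  by have [g [_ dg]] := elementary_partial i es; case: (dg x).
elim: s => [//|i s /(elementary_partial i)[g [eg dg]]] /=.
rewrite (_ : partial _ _ = g)//; apply/funext => x; rewrite /partial.
by case: (dg x).
Qed.

End elementary.
(** * Closures in L^2 *)
Section approximation.
Context d (T : measurableType d) (R : realType).
Variables (mu : {measure set T -> \bar R}) (D : set T).
Hypothesis mD : measurable D.
Implicit Types f g h w : T -> R.

Local Notation S := (sq_integrable mu D).
Local Notation l2_ip := (l2_ip mu D).
Local Notation weighted_ip := (weighted_ip mu D).

Let Ssub := subspace_sq_integrable mu mD.
Let ipS := symmetric_l2_ip mu mD.
Let ip0 f (_ : S f) := l2_ip_ge0 mu D f.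

Lemma weighted_ip_bound w (C : R) f : ess_bounded mu D w -> sq_integrable mu D f -> 0 <= C ->
  {ae mu, forall x, D x -> `|w x| <= C} -> `|weighted_ip w f f| <= C * l2_ip f f.
Proof.
move=> wb fs C0 wC; have cb k := @ess_bounded_cst _ _ _ mu D k.
have E k : k * l2_ip f f = weighted_ip (cst k) f f.
  rewrite -(@weighted_ipZ _ _ _ mu D mD k (cst 1))//; congr (weighted_ip _ _ _).
  by apply/funext => x; rewrite mulr1.
rewrite ler_norml -mulNr !E; apply/andP; split; apply: weighted_ip_le => //.
  by apply: filterS wC => x wC /wC; rewrite ler_norml => /andP[].
by apply: filterS wC => x wC /wC; rewrite ler_norml => /andP[].
Qed.

Lemma weighted_ip_cs w : ess_bounded mu D w -> exists2 C, 0 <= C &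
  forall f g, S f -> S g ->
    `|weighted_ip w f g| <= C * (Num.sqrt (l2_ip f f) * Num.sqrt (l2_ip g g)).
Proof.
move=> wb; have [mw [C wC]] := wb; exists `|C| => // f g fs gs.
apply: (form_dominated Ssub (symmetric_weighted_ip mD wb) ipS) => // u us.
apply: weighted_ip_bound => //.
by apply: filterS wC => x wC /wC h; rewrite (le_trans h)// ler_norm.
Qed.

Lemma sq_integrable_dominated f h : measurable_fun D f -> S h ->
  (forall x, D x -> `|f x| <= `|h x|) -> S f.
Proof.
move=> mf [mh hi] fh; split=> //; apply: (ae_dominated_integrable mD _ hi).
  exact: measurable_funX.
apply: aeW => x Dx; rewrite normrX -(real_normK (num_real (h x))).
by rewrite lerXn2r ?nnegrE// fh.
Qed.

Section approx.
Variable E : set (T -> R).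
Hypothesis ES : E `<=` S.
Hypothesis Esub : subspace_set E.

Definition l2_closure : set (T -> R) := [set f | S f /\
  forall e, 0 < e -> exists2 p, E p & l2_ip (f - p) (f - p) <= e].

Lemma sub_l2_closure : E `<=` l2_closure.
Proof.
move=> f Ef; split=> [|e e0]; first exact: ES.
by exists f => //; rewrite subrr (form0 Ssub ipS) ?ltW//; exact: Ssub.1.
Qed.

Lemma l2_closure_closed f : S f ->
  (forall e, 0 < e -> exists2 g, l2_closure g & l2_ip (f - g) (f - g) <= e) ->
  l2_closure f.
Proof.
move=> fs fcl; split=> // e e0; have e4 : 0 < e / 4 by rewrite divr_gt0.
have [g [gs gcl] fg] := fcl _ e4; have [p Ep gp] := gcl _ e4.
exists p => //; have := form_sqr_tri Ssub ipS ip0 fs gs (ES Ep).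
by move: fg gp; lra.
Qed.

Lemma subspace_l2_closure : subspace_set l2_closure.
Proof.
split=> [|a f g [fs fcl] [gs gcl]].
  by apply: sub_l2_closure; exact: Esub.1.
split=> [|e e0]; first exact: Ssub.2.
have ea : 0 < e / (4 * (a ^+ 2 + 1)).
  by rewrite divr_gt0// mulr_gt0// ltr_wpDl// sqr_ge0.
have [p Ep fp] := fcl _ ea; have [|q Eq gq] := gcl (e / 4); first by rewrite divr_gt0.
exists (a *: p + q); first exact: Esub.2.
have fps := subspaceB Ssub fs (ES Ep); have gqs := subspaceB Ssub gs (ES Eq).
have := form_sqr_tri Ssub ipS ip0 (subspaceD Ssub (subspaceZ Ssub a fps) gqs) gqs Ssub.1.
rewrite subr0 addrK (form_sqrZ Ssub ipS)// (_ : a *: (f - p) + _ = a *: f + g - (a *: p + q)); last first.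
  by rewrite scalerBr opprD addrACA.
move=> /le_trans; apply; rewrite subr0.
have h : a ^+ 2 * l2_ip (f - p) (f - p) <= e / 4.
  have a1 : 0 < a ^+ 2 + 1 by rewrite ltr_wpDl// sqr_ge0.
  rewrite (@le_trans _ _ ((a ^+ 2 + 1) * (e / (4 * (a ^+ 2 + 1)))))//.
    by rewrite ler_pM// ?sqr_ge0 ?ip0// lerDl.
  by rewrite le_eqVlt; apply/orP; left; apply/eqP; field; rewrite gt_eqF.
by move: gq h; lra.
Qed.

Lemma l2_closure_dominated (f_ : nat -> T -> R) f h :
  (forall k, l2_closure (f_ k)) -> measurable_fun D f -> S h ->
  (forall k x, D x -> `|f_ k x| <= `|h x|) ->
  (forall x, D x -> f_ ^~ x @ \oo --> f x) ->
  l2_closure f.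
Proof.
move=> fcl mf hs fh cf.
have fhx x : D x -> `|f x| <= `|h x|.
  move=> Dx; rewrite -(cvg_lim _ (cvg_norm (cf x Dx)))//; apply: limr_le.
    by apply/cvg_ex; eexists; exact: cvg_norm (cf x Dx).
  by apply: nearW => k; exact: fh.
have fs : S f by exact: (sq_integrable_dominated mf hs).
apply: l2_closure_closed => // e e0.
have fks k : S (f - f_ k) by apply: (subspaceB Ssub) => //; case: (fcl k).
pose F k x : \bar R := ((f x - f_ k x) ^+ 2)%:E.
have mF k : measurable_fun D (F k).
  by apply/measurable_EFinP; apply: measurable_funX; exact: (fks k).1.
have Fh : {ae mu, forall x, D x -> F ^~ x @ \oo --> (0 : \bar R)}.
  apply: aeW => x Dx; apply: cvg_EFin; first exact: nearW.
  have : (fun k => f x - f_ k x) @ \oo --> 0.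
    by rewrite -(subrr (f x)); apply: cvgB; [exact: cvg_cst|exact: cf].
  have c2 := @exprn_continuous R 2 0; rewrite /continuous_at expr0n/= in c2.
  by move=> c0; exact: (cvg_comp _ _ c0 c2).
have ih : mu.-integrable D (fun x => (4 * h x ^+ 2)%:E).
  by apply: real_integrableZ => //; exact: hs.2.
have Fb : {ae mu, forall x k, D x -> (`|F k x| <= (4 * h x ^+ 2)%:E)%E}.
  apply: aeW => x k Dx; rewrite /F /= ger0_norm ?sqr_ge0// lee_fin.
  rewrite -(real_normK (num_real (h x))) -(real_normK (num_real (f x - _))).
  have : `|f x - f_ k x| <= 2 * `|h x|.
    by rewrite (le_trans (ler_normB _ _))//; move: (fhx x Dx) (fh k x Dx); lra.
  move=> le2; rewrite (_ : 4 * _ = (2 * `|h x|) ^+ 2); last by ring.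
  by rewrite lerXn2r ?nnegrE ?mulr_ge0.
have m0 : measurable_fun D (fun=> 0 : \bar R) by exact: measurable_cst.
have [_ _] := dominated_convergence mD mF m0 Fh ih Fb.
rewrite integral0 => /fine_cvgP[_ /cvgrPdist_le/(_ e e0)[k _ /(_ k (leqnn k))]].
rewrite /= sub0r normrN => Fe; exists (f_ k) => //.
rewrite (le_trans _ Fe)// -[leLHS]/(fine (l2_ip (f - f_ k) (f - f_ k))%:E) EFin_l2_ip//.
exact: ler_norm.
Qed.

Lemma l2_closure_orth f g : S g -> (forall p, E p -> l2_ip g p = 0) ->
  l2_closure f -> l2_ip g f = 0.
Proof.
move=> gs gE [fs fcl]; apply/eqP; rewrite -normr_eq0 eq_le normr_ge0 andbT.
rewrite -oppr_ge0; apply: (@ge0_of_geom _ _ (Num.sqrt (l2_ip g g))) => k.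
rewrite lerN2; have [|p Ep fp] := fcl ((2^-1) ^+ k ^+ 2).
  by rewrite !exprn_gt0// invr_gt0.
have -> : l2_ip g f = l2_ip g (f - p).
  by rewrite (formBr Ssub ipS fs (ES Ep) gs) (gE _ Ep) subr0.
have fps := subspaceB Ssub fs (ES Ep).
rewrite (le_trans (form_cs Ssub ipS ip0 gs fps))// ler_wpM2l ?sqrtr_ge0//.
rewrite -[leRHS]ger0_norm; last by rewrite exprn_ge0// invr_ge0.
by rewrite -sqrtr_sqr ler_wsqrtr.
Qed.

(** For p in [E] close to f and e = f - p, expanding the form at p = f - e gives
    w(f, f) >= 2 w(e, f) - w(e, e), and the right-hand side is small. *)
Lemma l2_closure_ge0 f w : ess_bounded mu D w ->
  (forall p, E p -> 0 <= weighted_ip w p p) -> l2_closure f -> 0 <= weighted_ip w f f.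
Proof.
move=> wb wE [fs fcl]; have [C C0 wC] := weighted_ip_cs wb.
have wS := symmetric_weighted_ip mD wb.
apply: (@ge0_of_geom _ _ (C * (2 * Num.sqrt (l2_ip f f) + 1))) => k.
set t := 2^-1 ^+ k.
have t0 : 0 < t by rewrite exprn_gt0// invr_gt0.
have t1 : t <= 1 by rewrite exprn_ile1// ?invr_ge0// invf_le1// ler1n.
have [|p Ep fp] := fcl (t ^+ 2); first by rewrite exprn_gt0.
have fps := subspaceB Ssub fs (ES Ep).
have st : Num.sqrt (l2_ip (f - p) (f - p)) <= t.
  by rewrite -[leRHS](ger0_norm (ltW t0)) -sqrtr_sqr ler_wsqrtr.
have h1 := wC _ _ fps fs; have h2 := wC _ _ fps fps.
have h3 := wE p Ep.
have h4 : weighted_ip w p p = weighted_ip w f f - 2 * weighted_ip w (f - p) f + weighted_ip w (f - p) (f - p).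
  have e : p = f - (f - p) by rewrite opprB addrC subrK.
  by rewrite {1 2}e (form_sqrB Ssub wS)// (formC wS fs).
have s0 := sqrtr_ge0 (l2_ip (f - p) (f - p)).
set s := Num.sqrt (l2_ip (f - p) _) in st s0 h1 h2.
have h5 : C * (s * Num.sqrt (l2_ip f f)) <= C * (t * Num.sqrt (l2_ip f f)).
  by rewrite ler_wpM2l// ler_wpM2r// sqrtr_ge0.
have h6 : C * (s * s) <= C * t.
  rewrite ler_wpM2l//; have : s * s <= t * 1 by rewrite ler_pM// (le_trans st).
  by rewrite mulr1.
move: h1 h2; rewrite !ler_norml => /andP[h1 h1'] /andP[h2 h2'].
by move: h3; rewrite h4; move: h1' h2 h2' h5 h6; lra.
Qed.

End approx.
End approximation.
(** * Test functions *)
Section test_functions.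
Context (R : realType) (n : nat).
Variable Om : set 'rV[R]_n.
Hypothesis oOm : open Om.

Local Notation mu := (@lebesgue_rV R n).
Local Notation S := (sq_integrable mu Om).
Local Notation l2_ip := (l2_ip mu Om).
Local Notation weighted_ip := (weighted_ip mu Om).

Let mOm : measurable Om. Proof. exact: open_measurable_rV. Qed.

Lemma coord_le_norm (x : 'rV[R]_n) i : `|x 0 i| <= `|x|.
Proof.
rewrite [leRHS]/Num.norm/= mx_normrE.
exact: (le_bigmax _ (fun ij : 'I_1 * 'I_n => `|x ij.1 ij.2|) (0, i)).
Qed.

Lemma compact_sub_cube (K : set 'rV[R]_n) : compact K -> exists M, K `<=` cube M.
Proof.
move=> /compact_bounded[M [_ MK]]; exists (M + 1) => x Kx i.
by rewrite (le_trans (coord_le_norm x i))// MK// ltrDl.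
Qed.

Lemma compact_support_bounded (f : 'rV[R]_n -> R) (K : set 'rV[R]_n) :
  continuous f -> compact K -> (forall x, ~ K x -> f x = 0) ->
  exists C, forall x, `|f x| <= C.
Proof.
move=> cf cK f0; have /compact_bounded[C [_ CK]] : compact (f @` K).
  by apply: continuous_compact => //; exact: continuous_subspaceT.
exists (`|C| + 1) => x; have [Kx|/f0 ->] := pselect (K x); last first.
  by rewrite normr0 addr_ge0.
by apply: CK; [rewrite (le_lt_trans (ler_norm _))// ltrDl|exists x].
Qed.

(** Any compact set containing the support will do: such witnesses are easier to
    combine than the closure of the set where [f] is nonzero. *)
Definition compactly_supported (f : 'rV[R]_n -> R) :=
  exists K, [/\ compact K, K `<=` Om & forall x, ~ K x -> f x = 0].

Lemma compact_support_integrable (f : 'rV[R]_n -> R) :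
  continuous f -> compactly_supported f -> mu.-integrable setT (EFin \o f).
Proof.
move=> cf [K [cK _ f0]]; have [M KM] := compact_sub_cube cK.
have [C fC] := compact_support_bounded cf cK f0.
apply: (integrable_cube (continuous_measurable_rV cf) fC (M := M)) => x xM.
by apply: f0 => /KM.
Qed.

Lemma compact_support_sq_integrable (f : 'rV[R]_n -> R) :
  continuous f -> compactly_supported f -> S f.
Proof.
move=> cf [K [cK KO f0]]; have mf := continuous_measurable_rV cf.
split; first exact: measurable_funTS.
apply: (@integrableS _ _ _ _ setT) => //.
apply: compact_support_integrable.
  by move=> x; exact: (continuousM (cf x) (cf x)).
by exists K; split=> // x /f0 ->; rewrite expr0n.
Qed.

Lemma Rintegral_compactly_supported (f : 'rV[R]_n -> R) :
  compactly_supported f -> \int[mu]_(x in Om) f x = \int[mu]_x f x.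
Proof.
move=> [K [_ KO f0]]; rewrite Rintegral_mkcond; apply: eq_Rintegral => x _.
by rewrite patchE; case: ifPn => //; rewrite notin_setE => /(contra_not (KO x))/f0.
Qed.

Lemma compactly_supportedMl f g :
  compactly_supported g -> compactly_supported (fun x => f x * g x).
Proof.
by move=> [K [cK KO g0]]; exists K; split=> // x /g0 ->; rewrite mulr0.
Qed.

(** Test functions that can be multiplied by cutoffs of half-spaces and by waves. *)
Definition elementary_test : set ('rV[R]_n -> R) :=
  [set f | elementary f /\ compactly_supported f].

Lemma elementary_test_sq_integrable : elementary_test `<=` S.
Proof.
move=> f [ef sf]; apply: compact_support_sq_integrable => //.
exact: elementary_continuous.
Qed.

Lemma elementary_testMl f g :
  elementary f -> elementary_test g -> elementary_test (fun x => f x * g x).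
Proof. by move=> ef [eg sg]; split; [exact: elem_mul|exact: compactly_supportedMl]. Qed.

Lemma subspace_elementary_test : subspace_set elementary_test.
Proof.
split=> [|a f g [ef [K [cK KO f0]]] [eg [L [cL LO g0]]]].
  by split; [exact: (elem_cst n 0)|exists set0; split=> //; exact: compact0].
split; first by apply: elem_add => //; apply: elem_mul => //; exact: elem_cst.
exists (K `|` L); split=> [|x []|x /not_orP[xK xL]].
- exact: compactU.
- exact: KO.
- exact: LO.
- by rewrite !fctE f0// g0// [_ *: _]mulr0 addr0.
Qed.

Lemma continuous_partial (f : 'rV[R]_n -> R) i : smooth f ->
  continuous (partial i f).
Proof. by move=> /(_ [:: i])[]. Qed.

Lemma smooth_is_derive (f : 'rV[R]_n -> R) i x : smooth f ->
  is_derive x (delta_mx 0 i) f (partial i f x).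
Proof. by move=> /(_ [::])[_ df]; split=> //; exact: df. Qed.

(** Outside the compact set, [f] vanishes on a neighbourhood. *)
Lemma compactly_supported_partial (f : 'rV[R]_n -> R) i :
  compactly_supported f -> compactly_supported (partial i f).
Proof.
move=> [K [cK KO f0]]; exists K; split=> // x Kx.
have oK : open (~` K).
  by apply: closed_openC; apply: compact_closed => //; exact: norm_hausdorff.
rewrite /partial (@near_eq_derive _ _ _ _ (cst 0)) ?derive_cst//.
by near=> y; apply: f0; near: y; exact: open_nbhs_nbhs.
Unshelve. all: by end_near. Qed.

Lemma test_function_smooth phi : test_function Om phi -> smooth phi.
Proof. by case. Qed.

Lemma test_function_supported phi : test_function Om phi -> compactly_supported phi.
Proof.
case=> _ cK KO; exists (closure [set x | phi x != 0]); split=> // x.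
by move=> /(contra_not (@subset_closure _ _ _)) /negP; rewrite negbK => /eqP.
Qed.

Lemma elementary_test_function phi : elementary_test phi -> test_function Om phi.
Proof.
move=> [ep [K [cK KO p0]]].
have sK : closure [set x | phi x != 0] `<=` K.
  have /closure_id -> : closed K by apply: compact_closed => //; exact: norm_hausdorff.
  apply: closureS => x /= px; apply: contrapT => /p0 px0.
  by rewrite px0 eqxx in px.
split; first exact: elementary_smooth.
- by apply: (subclosed_compact _ cK) => //; exact: closed_closure.
- exact: subset_trans KO.
Qed.

(** The integral of the partial derivative of f g over R^n is 0, and g vanishes
    outside [Om]. *)
Lemma integration_by_parts (f g : 'rV[R]_n -> R) i :
  smooth f -> smooth g -> compactly_supported g ->
  \int[mu]_(x in Om) (f x * partial i g x) =
  - \int[mu]_(x in Om) (partial i f x * g x).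
Proof.
move=> sf sg cg; have cpg := compactly_supported_partial i cg.
have [cf _] := sf [::]; have [cg' _] := sg [::].
have cpf := @continuous_partial f i sf; have cpg' := @continuous_partial g i sg.
rewrite !Rintegral_compactly_supported; try exact: compactly_supportedMl.
pose h1 := fun x => f x * partial i g x; pose h2 := fun x => partial i f x * g x.
have ch1 : continuous h1 by move=> x; exact: (continuousM (cf x) (cpg' x)).
have ch2 : continuous h2 by move=> x; exact: (continuousM (cpf x) (cg' x)).
have i1 : mu.-integrable setT (EFin \o h1).
  by apply: compact_support_integrable => //; exact: compactly_supportedMl.
have i2 : mu.-integrable setT (EFin \o h2).
  by apply: compact_support_integrable => //; exact: compactly_supportedMl.
apply/eqP; rewrite -subr_eq0 opprK -RintegralD//; apply/eqP.
have ch : continuous (fun x => h1 x + h2 x).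
  by move=> x; exact: (continuousD (ch1 x) (ch2 x)).
have [K [cK KO g0]] := cg.
have [L [cL LO pg0]] := cpg.
have [M KM] := compact_sub_cube (compactU cK cL).
have h0 x : ~ (K `|` L) x -> f x * g x = 0 /\ h1 x + h2 x = 0.
  by move=> /not_orP[/g0 gx /pg0 pgx]; rewrite /h1 /h2 gx pgx !mulr0 addr0.
have [C hC] := compact_support_bounded ch (compactU cK cL) (fun x Kx => (h0 x Kx).2).
have dfg x : is_derive x (delta_mx 0 i) (fun x => f x * g x) (h1 x + h2 x).
  have H := is_deriveM (smooth_is_derive i x sf) (smooth_is_derive i x sg).
  by apply: (is_derive_eq H); rewrite /h1 /h2 /GRing.scale/= [g x * _]mulrC.
have fg0 x : ~ cube M x -> f x * g x = 0 /\ h1 x + h2 x = 0.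
  by move=> xM; apply: h0 => /KM.
by rewrite /Rintegral (integral_partial ch dfg hC fg0).
Qed.

Lemma weak_partial_smooth (f : 'rV[R]_n -> R) i :
  smooth f -> weak_partial Om i f (partial i f).
Proof.
move=> sf phi tphi; apply: integration_by_parts => //.
  exact: test_function_smooth.
exact: test_function_supported.
Qed.

(** Positive exactly on the open box with centre [q.1] and half-width [q.2]; the
    two flat factors cut off at its two faces orthogonal to the i-th axis. *)
Definition bump (q : 'rV[rat]_n * rat) : 'rV[R]_n -> R := fun x =>
  \prod_i (flat 0 (1 * x 0 i + (ratr q.2 - ratr (q.1 0 i))) *
           flat 0 (- 1 * x 0 i + (ratr q.2 + ratr (q.1 0 i)))).

Lemma elementary_bump q : elementary (bump q).
Proof. by apply: elementary_prod => i; apply: elem_mul; exact: elem_flat. Qed.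

Lemma bump_gt0 q x : rat_box q x -> 0 < bump q x.
Proof.
move=> xq; apply: prodr_gt0 => i _; have := xq i; rewrite ltr_norml => /andP[h1 h2].
by rewrite mulr_gt0// flat_gt0//; lra.
Qed.

Lemma bump_eq0 q x : ~ rat_cbox q x -> bump q x = 0.
Proof.
move=> /existsNP[i /negP]; rewrite -ltNge => h.
rewrite /bump (bigD1 i)//= (_ : flat _ _ * _ = 0) ?mul0r//.
move: h; rewrite ltNge ler_norml negb_and -!ltNge => /orP[h|h].
  by rewrite flat_le0 ?mul0r//; lra.
by rewrite mulrC flat_le0 ?mul0r//; lra.
Qed.

Lemma compact_rat_cbox q : compact (@rat_cbox R n q).
Proof.
pose A (i : 'I_n) : set R :=
  `[ratr (q.1 0 i) - ratr q.2, ratr (q.1 0 i) + ratr q.2]%classic.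
have cA i : compact (A i) by exact: segment_compact.
have := @rV_compact R n A cA.
congr compact; apply/seteqP; split=> x xq i; have := xq i; rewrite /A/= in_itv/=.
  by rewrite ler_norml => /andP[h1 h2]; apply/andP; split; lra.
by rewrite ler_norml => /andP[h1 h2]; apply/andP; split; lra.
Qed.

Lemma elementary_test_bump q : rat_cbox q `<=` Om -> elementary_test (bump q).
Proof.
move=> qO; split; first exact: elementary_bump.
exists (rat_cbox q); split=> //; first exact: compact_rat_cbox.
exact: bump_eq0.
Qed.

(** Countably many bumps cover [Om], so a property that holds almost everywhere
    on the support of each test function holds almost everywhere on [Om]. *)
Lemma ae_elementary_test (P : 'rV[R]_n -> Prop) :
  (forall phi, elementary_test phi ->
    {ae mu, forall x, Om x -> phi x != 0 -> P x}) ->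
  {ae mu, forall x, Om x -> P x}.
Proof.
move=> H; pose Q (k : nat) x := forall q, unpickle k = Some q ->
  rat_cbox q `<=` Om -> Om x -> bump q x != 0 -> P x.
have QE : {ae mu, forall x k, Q k x}.
  apply: ae_foralln => k; rewrite /Q; case: (unpickle k) => [q|]; last exact: aeW.
  have [qO|nqO] := pselect (rat_cbox q `<=` Om).
    by apply: filterS (H _ (elementary_test_bump qO)) => x Px _ [<-] _; exact: Px.
  by apply: aeW => x _ [<-] /nqO.
apply: filterS QE => x Qx Ox; have [q [xq qO]] := open_rat_box oOm Ox.
apply: (Qx (pickle q) q); rewrite ?pickleK//.
by rewrite gt_eqF// bump_gt0.
Qed.

End test_functions.
(** * Density of test functions *)
Section density.
Context (R : realType) (n : nat).
Variable Om : set 'rV[R]_n.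
Hypothesis oOm : open Om.

Local Notation mu := (@lebesgue_rV R n).
Local Notation S := (sq_integrable mu Om).
Local Notation l2_ip := (l2_ip mu Om).
Local Notation weighted_ip := (weighted_ip mu Om).
Local Notation E := (elementary_test Om).
Local Notation cl := (l2_closure mu Om E).

Let mOm : measurable Om := open_measurable_rV oOm.
Let ES : E `<=` S := elementary_test_sq_integrable oOm.
Let Esub : subspace_set E := subspace_elementary_test Om.
Let clsub : subspace_set cl := subspace_l2_closure mOm ES Esub.


Let cutoff (A : set 'rV[R]_n) (f : 'rV[R]_n -> R) := fun x => \1_A x * f x : R.

Let indic01 (A : set 'rV[R]_n) x : (\1_A x : R) = 0 \/ (\1_A x : R) = 1.
Proof. by rewrite indicE; case: (_ \in _); [right|left]. Qed.

Let cutoff_le A f x : `|cutoff A f x| <= `|f x|.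
Proof.
rewrite /cutoff; case: (indic01 A x) => ->; first by rewrite mul0r normr0.
by rewrite mul1r.
Qed.

(** Asking for products with all test functions, instead of the indicator function
    alone, makes this family closed under intersections. *)
Definition cutoff_stable : set (set 'rV[R]_n) := [set A | measurable A /\
  forall phi, E phi -> cl (cutoff A phi)].

Lemma cutoff_closure A f : cutoff_stable A -> cl f -> cl (cutoff A f).
Proof.
move=> [mA EA] [fs fcl].
have mc g : S g -> S (cutoff A g).
  move=> gs; apply: (sq_integrable_dominated mOm _ gs) => [|x _]; last exact: cutoff_le.
  by apply: measurable_funM; [exact: measurable_indic|exact: gs.1].
apply: (l2_closure_closed mOm ES) => [|e e0]; first exact: mc.
have [p Ep fp] := fcl _ e0; exists (cutoff A p); first exact: EA.
rewrite (le_trans _ fp)// !l2_ipE.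
have fps : S (f - p) := subspaceB (subspace_sq_integrable mu mOm) fs (ES Ep).
have -> : cutoff A f - cutoff A p = cutoff A (f - p).
  by apply/funext => x; rewrite /cutoff !fctE mulrBr.
apply: ae_le_Rintegral => //.
- by apply: sq_integrableM => //; exact: mc.
- exact: sq_integrableM.
- apply: aeW => x _; rewrite -!expr2 -(real_normK (num_real (cutoff _ _ _))).
  by rewrite -(real_normK (num_real ((f - p) x))) lerXn2r ?nnegrE.
Qed.

Lemma cutoff_stableC A : cutoff_stable A -> cutoff_stable (~` A).
Proof.
move=> [mA EA]; split=> [|phi Ephi]; first exact: measurableC.
have -> : cutoff (~` A) phi = phi - cutoff A phi.
  apply/funext => x; rewrite /cutoff !fctE !indicE in_setC.
  by case: (x \in A); rewrite /= ?mul0r ?mul1r ?subrr ?subr0.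
apply: (subspaceB clsub); last exact: EA.
exact: (sub_l2_closure mOm ES).
Qed.

Lemma cutoff_stableI A B : cutoff_stable A -> cutoff_stable B ->
  cutoff_stable (A `&` B).
Proof.
move=> sA sB; split=> [|phi Ephi]; first by apply: measurableI; [exact: sA.1|exact: sB.1].
have -> : cutoff (A `&` B) phi = cutoff A (cutoff B phi).
  by apply/funext => x; rewrite /cutoff mulrA indicI.
by apply: cutoff_closure => //; exact: sB.2.
Qed.

Lemma cutoff_stableT : cutoff_stable setT.
Proof.
split=> [//|phi Ephi]; rewrite (_ : cutoff _ _ = phi).
  exact: (sub_l2_closure mOm ES).
by apply/funext => x; rewrite /cutoff indicT mul1r.
Qed.

Lemma cutoff_stable_bigcap (A : nat -> set 'rV[R]_n) :
  (forall k, cutoff_stable (A k)) -> cutoff_stable (\bigcap_k A k).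
Proof.
move=> sA.
have sB k : cutoff_stable (\bigcap_(i < k) A i).
  rewrite bigcap_mkord; elim: k => [|k IH]; first by rewrite big_ord0; exact: cutoff_stableT.
  by rewrite big_ord_recr; exact: cutoff_stableI.
split=> [|phi Ephi]; first by apply: bigcapT_measurable => k; exact: (sA k).1.
apply: (@l2_closure_dominated _ _ _ _ _ mOm _ ES (fun k => cutoff (\bigcap_(i < k) A i) phi) _ phi).
- by move=> k; exact: (sB k).2.
- apply: measurable_funM; last exact: (ES Ephi).1.
  by apply: measurable_indic; apply: bigcapT_measurable => k; exact: (sA k).1.
- exact: ES.
- by move=> k x _; exact: cutoff_le.
- move=> x _; have [xA|/existsNP[k xk]] := pselect ((\bigcap_k A k) x).
    apply: cvg_near_cst; apply: nearW => k; rewrite /cutoff !indicE !mem_set//.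
    by move=> i _; exact: xA.
  apply: cvg_near_cst; exists k.+1 => // j /= kj; rewrite /cutoff !indicE !memNset//.
    by move=> /(_ k I).
  by move=> /(_ k kj); have := xk; apply: contra_not.
Qed.

Lemma cutoff_stable_halfspace (i : 'I_n) (a : R) :
  cutoff_stable [set x | a < x 0 i].
Proof.
have mA : measurable [set x : 'rV[R]_n | a < x 0 i].
  rewrite -[X in measurable X]setTI.
  have := @measurable_coord R n i measurableT _ (measurable_itv `]a, +oo[).
  by congr (measurable (_ `&` _)); apply/seteqP; split=> x; rewrite /= in_itv/= andbT.
split=> // phi Ephi.
pose h (k : nat) (x : 'rV[R]_n) := flat 0 (k%:R * x 0 i + - (k%:R * a)).
have eh k : elementary (h k) by exact: elem_flat.
apply: (@l2_closure_dominated _ _ _ _ _ mOm _ ES (fun k x => h k x * phi x) _ phi).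
- by move=> k; apply: (sub_l2_closure mOm ES); exact: elementary_testMl.
- by apply: measurable_funM; [exact: measurable_indic|exact: (ES Ephi).1].
- exact: ES.
- move=> k x _; rewrite normrM ger0_norm ?flat_ge0//.
  by rewrite ler_piMl// flat0_le1.
- move=> x _; apply: cvgMr_tmp; rewrite indicE /h.
  under eq_fun do rewrite -mulrBr.
  have [ax|xa] := ltP a (x 0 i).
    by rewrite mem_set//; apply: cvg_flat0; rewrite subr_gt0.
  rewrite memNset /=; last by apply/negP; rewrite -leNgt.
  by apply: cvg_near_cst; apply: nearW => k; rewrite flat_le0// mulr_ge0_le0// subr_le0.
Qed.

Lemma cutoff_stable_bigcup (A : nat -> set 'rV[R]_n) :
  (forall k, cutoff_stable (A k)) -> cutoff_stable (\bigcup_k A k).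
Proof.
move=> sA; rewrite -[X in cutoff_stable X]setCK setC_bigcup.
by apply/cutoff_stableC/cutoff_stable_bigcap => k; exact: cutoff_stableC.
Qed.

Lemma cutoff_stable_preimage (i : 'I_n) (Y : set (measurableTypeR R)) :
  measurable Y -> cutoff_stable ((fun x : 'rV[R]_n => x 0 i) @^-1` Y).
Proof.
rewrite RGenOInfty.measurableE; move: Y; apply: smallest_sub => [|_ [a ->]].
  split=> [|B sB|F sF].
  - by rewrite preimage_set0 -setCT; exact/cutoff_stableC/cutoff_stableT.
  - by rewrite setTD preimage_setC; exact: cutoff_stableC.
  - by rewrite preimage_bigcup; exact: cutoff_stable_bigcup.
have := cutoff_stable_halfspace i a; congr cutoff_stable.
by apply/seteqP; split=> x; rewrite /= in_itv/= andbT.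
Qed.

(** The family is a sigma-algebra that contains the half-spaces. *)
Lemma cutoff_stable_measurable (A : set 'rV[R]_n) : measurable A -> cutoff_stable A.
Proof.
move: A; apply: smallest_sub => [|A].
  split=> [|B sB|F sF].
  - by rewrite -setCT; exact/cutoff_stableC/cutoff_stableT.
  - by rewrite setTD; exact: cutoff_stableC.
  - exact: cutoff_stable_bigcup.
rewrite -bigcup_seq => -[i _ [Y mY <-]].
by rewrite setTI; exact: cutoff_stable_preimage.
Qed.

(** By density g is orthogonal to phi times any indicator function, so g phi
    vanishes almost everywhere, for each test function phi. *)
Lemma fundamental_lemma g : S g -> (forall phi, E phi -> l2_ip g phi = 0) ->
  {ae mu, forall x, Om x -> g x = 0}.
Proof.
move=> gs gE; apply: (ae_elementary_test oOm) => phi Ephi.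
have gi : mu.-integrable Om (EFin \o (fun x => g x * phi x)).
  by apply: sq_integrableM => //; exact: ES.
have : ae_eq mu Om (EFin \o (fun x => g x * phi x)) (cst 0%E).
  apply: integral_ae_eq => // B BO mB; rewrite integral0.
  have gB : \int[mu]_(x in B) (g x * phi x) = 0.
    rewrite -(setIidr BO) Rintegral_mkcondr.
    have := l2_closure_orth mOm ES gs gE ((cutoff_stable_measurable mB).2 _ Ephi).
    rewrite l2_ipE => H; rewrite -[RHS]H; apply: eq_Rintegral => x _.
    rewrite patchE /cutoff indicE; case: (x \in B); rewrite ?mul1r// mul0r mulr0//.
  rewrite -[LHS]fineK; first by rewrite [X in X%:E]gB.
  by apply: integrable_fin_num => //; exact: integrableS gi.
apply: filterS => x /[apply] -[] /eqP; rewrite mulf_eq0 => /orP[/eqP//|->//].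
Qed.

(** By density the inequality extends to phi times the indicator function of the
    set where w is negative. *)
Lemma weighted_ip_ge0_ae w : ess_bounded mu Om w ->
  (forall phi, E phi -> 0 <= weighted_ip w phi phi) ->
  {ae mu, forall x, Om x -> 0 <= w x}.
Proof.
move=> wb wE; apply: (ae_elementary_test oOm) => phi Ephi.
have [mw _] := wb.
pose A := Om `&` [set x | w x < 0].
have mA : measurable A.
  have := mw mOm _ (measurable_itv `]-oo, 0[); congr measurable.
have clA := (cutoff_stable_measurable mA).2 _ Ephi.
have := l2_closure_ge0 mOm ES wb wE clA.
set f := cutoff A phi in clA *; have fs : S f := clA.1 => wf.
pose h x := w x * (f x * f x).
have hi : mu.-integrable Om (EFin \o h) by exact: weighted_ip_integrable.
have h0 x : Om x -> h x <= 0.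
  move=> Ox; rewrite /h /f /cutoff indicE; have [|xA] := boolP (x \in A).
    rewrite inE => -[_ /= w0]; rewrite mul1r -expr2.
    by apply: mulr_le0_ge0; [exact: ltW|exact: sqr_ge0].
  by rewrite mul0r mulr0 mulr0.
have /(ae_eq_integral_abs mu mOm)[+ _] : measurable_fun Om (EFin \o h).
  by apply/measurable_EFinP; exact: (real_integrable_measurable hi).
have -> : (\int[mu]_(x in Om) `|(EFin \o h) x|)%E = 0%E.
  apply/eqP; rewrite eq_le integral_ge0// andbT.
  have iN : mu.-integrable Om (EFin \o (fun x => - 1 * h x)) by exact: real_integrableZ.
  rewrite (eq_integral (EFin \o (fun x => - 1 * h x))) => [|x /[!inE] Ox]; last first.
    by rewrite /= ler0_norm ?h0// mulN1r.
  rewrite -[leLHS]fineK; last exact: integrable_fin_num.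
  by rewrite lee_fin [leLHS]RintegralZl// mulN1r oppr_le0.
move=> /(_ erefl); apply: filterS => x hx Ox px; rewrite leNgt; apply/negP => wx.
have := hx Ox; rewrite /= => -[] /eqP; apply/negP.
rewrite /h /f /cutoff indicE mem_set//= mul1r.
by rewrite !mulf_neq0// lt_eqF.
Qed.

End density.
(** * The space H^1 and the energy form *)
Section sobolev_space.
Context (R : realType) (n : nat).
Variable Om : set 'rV[R]_n.
Hypothesis oOm : open Om.

Local Notation mu := (@lebesgue_rV R n).
Local Notation S := (sq_integrable mu Om).
Local Notation l2_ip := (l2_ip mu Om).
Local Notation weighted_ip := (weighted_ip mu Om).
Local Notation H1 := (H1 Om).

Let mOm : measurable Om := open_measurable_rV oOm.
Let Ssub := subspace_sq_integrable mu mOm.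
Let ipS := symmetric_l2_ip mu mOm.
Let ip0 f (_ : S f) := l2_ip_ge0 mu Om f.

Lemma Lp_on2P f : Lp_on Om 2%:E f <-> S f.
Proof.
have rE : (EFin \o (fun x => f x ^+ 2)) \_ Om = EFin \o (fun x => (f \_ Om) x ^+ 2).
  by apply/funext => x; rewrite patchE /= patchE; case: ifP => // _; rewrite expr0n.
split=> [fL|[mf fi]].
  have := Lfun2_integrable_sqr fL; rewrite -rE => fi; split.
    apply/(measurable_restrictT _ mOm).
    by move: fL => /andP[]; rewrite inE.
  exact/integrable_mkcond.
have mfO : measurable_fun setT (f \_ Om) by apply/(measurable_restrictT _ mOm).
apply/andP; split; rewrite inE//= /finite_norm unlock.
apply: poweR_lty.
move/integrable_mkcond : fi; rewrite rE => /(_ mOm) /integrableP[_].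
apply: le_lt_trans; rewrite le_eqVlt; apply/orP; left; apply/eqP.
by apply: eq_integral => x _; rewrite /= normrX powR_mulrn.
Qed.

Lemma test_function_sq_integrable phi : test_function Om phi -> S phi.
Proof.
move=> tphi; apply: compact_support_sq_integrable => //.
  by have [/(_ [::])[]] := tphi.
exact: test_function_supported.
Qed.

Lemma test_partial_sq_integrable i phi : test_function Om phi -> S (partial i phi).
Proof.
move=> tphi; have sphi := test_function_smooth tphi.
apply: compact_support_sq_integrable => //; first exact: continuous_partial.
by apply: compactly_supported_partial; exact: test_function_supported.
Qed.

Lemma weak_partialP i u g : weak_partial Om i u g <->
  forall phi, test_function Om phi -> l2_ip u (partial i phi) = - l2_ip g phi.
Proof.
by split=> H phi tphi; have := H phi tphi; rewrite !l2_ipE.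
Qed.

Lemma weak_partialL i (a : R) u v g h : S u -> S v -> S g -> S h ->
  weak_partial Om i u g -> weak_partial Om i v h ->
  weak_partial Om i (a *: u + v) (a *: g + h).
Proof.
move=> us vs gs hs /weak_partialP wu /weak_partialP wv; apply/weak_partialP => phi tphi.
have ps := test_function_sq_integrable tphi; have dps := test_partial_sq_integrable i tphi.
rewrite (ipS.2 _ dps a u v us vs) (ipS.2 _ ps a g h gs hs) wu// wv//.
by rewrite mulrN opprD.
Qed.

Lemma weak_partial_unique i u g h : S g -> S h ->
  weak_partial Om i u g -> weak_partial Om i u h ->
  {ae mu, forall x, Om x -> g x = h x}.
Proof.
move=> gs hs /weak_partialP wg /weak_partialP wh.
have : {ae mu, forall x, Om x -> (g - h) x = 0}.
  apply: (fundamental_lemma oOm); first exact: subspaceB.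
  move=> phi ephi; have tphi := elementary_test_function ephi.
  have ps := test_function_sq_integrable tphi.
  rewrite (formBl Ssub ipS gs hs ps); apply/eqP; rewrite subr_eq0 -eqr_opp.
  by rewrite -wg// -wh.
by apply: filterS => x gh Ox; apply/eqP; rewrite -subr_eq0; apply/eqP; exact: gh.
Qed.

Lemma H1_sq_integrable u : H1 u -> S u.
Proof. by case=> /Lp_on2P. Qed.

Lemma wpartialP u i : H1 u ->
  S (wpartial Om u i) /\ weak_partial Om i u (wpartial Om u i).
Proof.
move=> [_ /(_ i)[g gL wg]].
by have [/Lp_on2P] : [set g | Lp_on Om 2%:E g /\ weak_partial Om i u g]
    (wpartial Om u i) by apply: xgetPex; exists g.
Qed.

Lemma wpartial_sq_integrable u i : H1 u -> S (wpartial Om u i).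
Proof. by move=> /(wpartialP i)[]. Qed.

Lemma H1P u (g : 'I_n -> 'rV[R]_n -> R) : S u -> (forall i, S (g i)) ->
  (forall i, weak_partial Om i u (g i)) -> H1 u.
Proof.
by move=> us gs wg; split=> [|i]; [exact/Lp_on2P|exists (g i) => //; exact/Lp_on2P].
Qed.

Lemma wpartial_unique u i g : H1 u -> S g -> weak_partial Om i u g ->
  {ae mu, forall x, Om x -> wpartial Om u i x = g x}.
Proof.
move=> Hu gs wg; have [ws wu] := wpartialP i Hu.
exact: weak_partial_unique wu wg.
Qed.

Lemma wpartial_lin_weak u v i (a : R) : H1 u -> H1 v ->
  weak_partial Om i (a *: u + v) (a *: wpartial Om u i + wpartial Om v i).
Proof.
move=> Hu Hv; have [us wu] := wpartialP i Hu; have [vs wv] := wpartialP i Hv.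
by apply: weak_partialL => //; exact: H1_sq_integrable.
Qed.

Lemma subspace_H1 : subspace_set H1.
Proof.
split=> [|a u v Hu Hv].
  apply: (@H1P _ (fun=> 0)) => [|_|i]; try exact: Ssub.1.
  apply/weak_partialP => phi tphi; rewrite !(form0 Ssub ipS) ?oppr0//.
    exact: test_function_sq_integrable.
  exact: test_partial_sq_integrable.
apply: (@H1P _ (fun i => a *: wpartial Om u i + wpartial Om v i)) => [|i|i].
- by apply: Ssub.2; exact: H1_sq_integrable.
- by apply: Ssub.2; exact: wpartial_sq_integrable.
- exact: wpartial_lin_weak.
Qed.

(** The representatives are chosen separately, so linearity holds only almost
    everywhere. *)
Lemma wpartial_lin u v i (a : R) : H1 u -> H1 v ->
  {ae mu, forall x, Om x ->
    wpartial Om (a *: u + v) i x = (a *: wpartial Om u i + wpartial Om v i) x}.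
Proof.
move=> Hu Hv; apply: wpartial_unique; first exact: subspace_H1.2.
  by apply: Ssub.2; exact: wpartial_sq_integrable.
exact: wpartial_lin_weak.
Qed.

(** A sum over coordinates, so that each term is a form on L^2; [grad_formE]
    identifies it with the integral of s grad u . grad v. *)
Definition grad_form (s : 'rV[R]_n -> R) u v : R :=
  \sum_i weighted_ip s (wpartial Om u i) (wpartial Om v i).

Definition energy_form s u v : R := grad_form s u v + l2_ip u v.

Local Notation bounded := (ess_bounded mu Om).

Let bounded1 : bounded (cst 1) := ess_bounded_cst mu Om 1.

Lemma grad_formE s u v : bounded s -> H1 u -> H1 v ->
  \int[mu]_(x in Om) (s x * dot (wgrad Om u x) (wgrad Om v x)) = grad_form s u v.
Proof.
move=> sb Hu Hv.
transitivity (\int[mu]_(x in Om)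
    (\sum_i s x * (wpartial Om u i x * wpartial Om v i x))).
  apply: eq_Rintegral => x _; rewrite /dot mulr_sumr.
  by apply: eq_bigr => i _; rewrite !mxE.
apply: (Rintegral_sum mOm _ _).2 => i.
by apply: weighted_ip_integrable => //; exact: wpartial_sq_integrable.
Qed.

Lemma AN_energy s u v : bounded s -> H1 u -> H1 v ->
  AN Om s u v = energy_form s u v.
Proof. by move=> sb Hu Hv; rewrite /AN grad_formE// /energy_form l2_ipE. Qed.

Lemma H1_normE u : H1 u -> H1_norm Om u = Num.sqrt (energy_form (cst 1) u u).
Proof.
move=> Hu; rewrite /H1_norm /energy_form -grad_formE// l2_ipE.
congr (Num.sqrt (_ + _)).
by apply: eq_Rintegral => x _; rewrite mul1r.
Qed.

Lemma symmetric_grad_form s : bounded s -> symmetric_form_on H1 (grad_form s).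
Proof.
move=> sb; have sS := symmetric_weighted_ip mOm sb.
split=> [u v Hu Hv|w Hw a u v Hu Hv].
  by apply: eq_bigr => i _; apply: (formC sS); exact: wpartial_sq_integrable.
rewrite /grad_form mulr_sumr -big_split/=; apply: eq_bigr => i _.
have [us vs ws] := And3 (wpartial_sq_integrable i Hu) (wpartial_sq_integrable i Hv) (wpartial_sq_integrable i Hw).
rewrite -(sS.2 _ ws a _ _ us vs); apply: ae_eq_weighted_ip => //.
- exact/wpartial_sq_integrable/subspace_H1.2.
- exact: Ssub.2.
- exact: wpartial_lin.
- exact: aeW.
Qed.

Lemma symmetric_energy_form s : bounded s -> symmetric_form_on H1 (energy_form s).
Proof.
move=> sb; have sS := symmetric_grad_form sb.
split=> [u v Hu Hv|w Hw a u v Hu Hv].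
  by rewrite /energy_form (formC sS)// (formC ipS)//; exact: H1_sq_integrable.
rewrite /energy_form (sS.2 w Hw)// (ipS.2 w (H1_sq_integrable Hw)); try exact: H1_sq_integrable.
move: (grad_form s u w) (grad_form s v w) (l2_ip u w) (l2_ip v w) => A B C D.
ring.
Qed.

Lemma grad_form_le s t u : bounded s -> bounded t -> H1 u ->
  {ae mu, forall x, Om x -> s x <= t x} -> grad_form s u u <= grad_form t u u.
Proof.
move=> sb tb Hu st; apply: ler_sum => i _.
by apply: weighted_ip_le => //; exact: wpartial_sq_integrable.
Qed.

Lemma grad_formZ k s u v : bounded s -> H1 u -> H1 v ->
  grad_form (fun x => k * s x) u v = k * grad_form s u v.
Proof.
move=> sb Hu Hv; rewrite /grad_form mulr_sumr; apply: eq_bigr => i _.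
by apply: weighted_ipZ => //; exact: wpartial_sq_integrable.
Qed.

Lemma grad_formB s t u v : bounded s -> bounded t -> H1 u -> H1 v ->
  grad_form (fun x => s x - t x) u v = grad_form s u v - grad_form t u v.
Proof.
move=> sb tb Hu Hv; rewrite /grad_form -sumrB; apply: eq_bigr => i _.
by apply: weighted_ipB => //; exact: wpartial_sq_integrable.
Qed.

Lemma grad_form_cst k u : H1 u -> grad_form (cst k) u u = k * grad_form (cst 1) u u.
Proof.
move=> Hu; rewrite -grad_formZ//; congr (grad_form _ _ _).
by apply/funext => x; rewrite mulr1.
Qed.

Lemma grad_form1_ge0 u : 0 <= grad_form (cst 1) u u.
Proof. by apply: sumr_ge0 => i _; exact: l2_ip_ge0. Qed.

Lemma energy1_ge0 u : 0 <= energy_form (cst 1) u u.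
Proof. by rewrite addr_ge0 ?grad_form1_ge0 ?l2_ip_ge0. Qed.

Lemma grad_form_bound s (C : R) u : bounded s -> H1 u -> 0 <= C ->
  {ae mu, forall x, Om x -> `|s x| <= C} ->
  `|grad_form s u u| <= C * energy_form (cst 1) u u.
Proof.
move=> sb Hu C0 sC.
have h : `|grad_form s u u| <= C * grad_form (cst 1) u u.
  rewrite /grad_form mulr_sumr (le_trans (ler_norm_sum _ _ _))//.
  by apply: ler_sum => i _; apply: weighted_ip_bound => //; exact: wpartial_sq_integrable.
by rewrite (le_trans h)// ler_wpM2l// lerDl l2_ip_ge0.
Qed.

Section coercive.
Variables (s : 'rV[R]_n -> R) (s0 s1 : R).
Hypothesis sb : bounded s.
Hypothesis s00 : 0 < s0.
Hypothesis ss : {ae mu, forall x, Om x -> s0 <= s x <= s1}.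
Let m0 := Num.min s0 1.
Let m1 := Num.max s1 1.

Let m00 : 0 < m0. Proof. by rewrite lt_min s00 ltr01. Qed.

Lemma energy_coercive u : H1 u ->
  m0 * energy_form (cst 1) u u <= energy_form s u u.
Proof.
move=> Hu; have : grad_form (cst s0) u u <= grad_form s u u.
  apply: grad_form_le => //; first exact: ess_bounded_cst.
  by apply: filterS ss => x /[apply] /andP[].
rewrite grad_form_cst// /energy_form mulrDr; move: (grad_form1_ge0 u) (l2_ip_ge0 mu Om u).
set G := grad_form _ _ _; set I := l2_ip _ _ => G0 I0 h.
have h1 : m0 * G <= s0 * G by rewrite ler_wpM2r// ge_min lexx.
have h2 : m0 * I <= I by rewrite ler_piMl// ge_min lexx orbT.
by move: h h1 h2; lra.
Qed.

Lemma energy_bounded u : H1 u ->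
  energy_form s u u <= m1 * energy_form (cst 1) u u.
Proof.
move=> Hu; have : grad_form s u u <= grad_form (cst s1) u u.
  apply: grad_form_le => //; first exact: ess_bounded_cst.
  by apply: filterS ss => x /[apply] /andP[].
rewrite grad_form_cst// /energy_form mulrDr; move: (grad_form1_ge0 u) (l2_ip_ge0 mu Om u).
set G := grad_form _ _ _; set I := l2_ip _ _ => G0 I0 h.
have h1 : s1 * G <= m1 * G by rewrite ler_wpM2r// le_max lexx.
have h2 : I <= m1 * I by rewrite ler_peMl// le_max lexx orbT.
by move: h h1 h2; lra.
Qed.

Lemma energy_ge0 u : H1 u -> 0 <= energy_form s u u.
Proof.
move=> Hu; apply: le_trans (energy_coercive Hu).
by rewrite mulr_ge0 ?energy1_ge0// ltW.
Qed.

Lemma l2_ip_fast_limit f g (u : nat -> 'rV[R]_n -> R) (D : R) : S f -> S g ->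
  (forall k, S (u k)) ->
  (forall k, l2_ip (u k - f) (u k - f) <= D * 8^-1 ^+ k) ->
  exists C, forall k, `|l2_ip (u k) g - l2_ip f g| <= C * 2^-1 ^+ k.
Proof.
move=> fs gs us ufD; exists (Num.sqrt D * Num.sqrt (l2_ip g g)) => k.
have D0 : 0 <= D.
  by have := ufD 0%N; rewrite expr0 mulr1; apply: le_trans; exact: l2_ip_ge0.
have ufs := subspaceB Ssub (us k) fs.
rewrite -(formBl Ssub ipS (us k) fs gs) (le_trans (form_cs Ssub ipS ip0 ufs gs))//.
rewrite mulrAC ler_wpM2r ?sqrtr_ge0//.
have p0 : 0 <= 2^-1 ^+ k :> R by rewrite exprn_ge0// invr_ge0.
rewrite -[2^-1 ^+ k]ger0_norm// -sqrtr_sqr -sqrtrM// ler_wsqrtr//.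
rewrite (le_trans (ufD k))// ler_wpM2l// -exprM mulnC exprM.
by rewrite lerXn2r ?nnegrE ?invr_ge0 ?exprn_ge0// ?invr_ge0//; lra.
Qed.

(** A Cauchy sequence and its weak derivatives converge in L^2, and the defining
    identity of weak derivatives passes to the limit. *)
Lemma complete_energy : complete_form_on H1 (energy_form s).
Proof.
move=> u C Hu uC.
have H1B k j := subspaceB subspace_H1 (Hu j) (Hu k).
have us k := H1_sq_integrable (Hu k).
have uC' k j : (k <= j)%N ->
    energy_form (cst 1) (u j - u k) (u j - u k) <= C / m0 * 8^-1 ^+ k.
  move=> kj; rewrite mulrAC ler_pdivlMr// mulrC.
  by rewrite (le_trans _ (uC _ _ kj))// energy_coercive.
have [v [vs [D vD]]] : exists v, S v /\ exists D : R,
    forall k, l2_ip (u k - v) (u k - v) <= D * 8^-1 ^+ k.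
  apply: (complete_l2_ip mOm us (C := C / m0)) => k j kj.
  by rewrite (le_trans _ (uC' _ _ kj))// lerDr grad_form1_ge0.
have dB i k j : {ae mu, forall x, Om x -> wpartial Om (u j - u k) i x =
    (wpartial Om (u j) i - wpartial Om (u k) i) x}.
  have := wpartial_lin i (-1) (Hu k) (Hu j).
  by rewrite !scaleN1r ![- _ + _]addrC.
have /choice[g gP] : forall i, exists g, S g /\ exists D : R,
    forall k, l2_ip (wpartial Om (u k) i - g) (wpartial Om (u k) i - g) <= D * 8^-1 ^+ k.
  move=> i; have ws k := wpartial_sq_integrable i (Hu k).
  apply: (complete_l2_ip mOm ws (C := C / m0)) => k j kj.
  rewrite (le_trans _ (uC' _ _ kj))// /energy_form /grad_form (bigD1 i)//=.
  have ds := subspaceB Ssub (ws j) (ws k).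
  have dus := wpartial_sq_integrable i (H1B k j).
  rewrite -[X in X <= _](ae_eq_weighted_ip mOm bounded1 dus ds dus ds (dB i k j) (dB i k j)).
  by rewrite -addrA lerDl addr_ge0 ?l2_ip_ge0// sumr_ge0// => l _; exact: l2_ip_ge0.
have gs i := (gP i).1; have gD i := (gP i).2.
have wg i : weak_partial Om i v (g i).
  apply/weak_partialP => phi tphi.
  have ps := test_function_sq_integrable tphi; have dps := test_partial_sq_integrable i tphi.
  have [C1 h1] := l2_ip_fast_limit vs dps us vD.
  have [Di giD] := gD i.
  have [C2 h2] := l2_ip_fast_limit (gs i) ps (fun k => wpartial_sq_integrable i (Hu k)) giD.
  apply/eqP; rewrite -subr_eq0 opprK -normr_eq0 eq_le normr_ge0 andbT -oppr_ge0.
  apply: (@ge0_of_geom _ _ (C1 + C2)) => k; rewrite lerN2.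
  have /weak_partialP/(_ phi tphi) w := (wpartialP i (Hu k)).2.
  rewrite (_ : l2_ip v _ + _ = - ((l2_ip (u k) (partial i phi) - l2_ip v (partial i phi)) +
      (l2_ip (wpartial Om (u k) i) phi - l2_ip (g i) phi))); last by rewrite w; ring.
  rewrite normrN mulrDl (le_trans (ler_normD _ _))// lerD//.
have Hv : H1 v by exact: (H1P vs gs wg).
exists v; split=> //.
have /choice[D' gD'] := gD.
exists (m1 * (\sum_i D' i + D)) => k.
have HB := subspaceB subspace_H1 (Hu k) Hv.
rewrite (le_trans (energy_bounded HB))// -mulrA ler_wpM2l//.
  by rewrite le_max ler01 orbT.
rewrite mulrDl /energy_form lerD// mulr_suml; apply: ler_sum => i _.
have wgs := subspaceB Ssub (wpartial_sq_integrable i (Hu k)) (gs i).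
have wae : {ae mu, forall x, Om x -> wpartial Om (u k - v) i x =
    (wpartial Om (u k) i - g i) x}.
  apply: wpartial_unique => //.
  have := weak_partialL (-1) vs (us k) (gs i) (wpartial_sq_integrable i (Hu k)) (wg i) (wpartialP i (Hu k)).2.
  by rewrite !scaleN1r ![- _ + _]addrC.
have Bs := wpartial_sq_integrable i HB.
by rewrite (ae_eq_weighted_ip mOm bounded1 Bs wgs Bs wgs wae wae); exact: gD'.
Qed.

Lemma energy_representation F : H1_dual Om F ->
  exists u, H1 u /\ forall v, H1 v -> AN Om s u v = F v.
Proof.
move=> [FL [C FC]].
have [|||||u [Hu uF]] := @riesz _ _ _ subspace_H1 (energy_form s) F.
- exact: symmetric_energy_form.
- exact: energy_ge0.
- exact: complete_energy.
- exact: FL.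
- exists (`|C| / Num.sqrt m0) => u Hu; rewrite (le_trans (FC u Hu))//.
  rewrite mulrAC ler_pdivlMr ?sqrtr_gt0// -mulrA.
  have h : H1_norm Om u * Num.sqrt m0 <= Num.sqrt (energy_form s u u).
    rewrite H1_normE// mulrC -sqrtrM; last exact: ltW.
    by rewrite ler_wsqrtr// energy_coercive.
  have n0 : 0 <= H1_norm Om u * Num.sqrt m0 by rewrite mulr_ge0 ?sqrtr_ge0.
  by rewrite (@le_trans _ _ (`|C| * (H1_norm Om u * Num.sqrt m0)))// ?ler_wpM2r ?ler_wpM2l// ler_norm.
by exists u; split=> // v Hv; rewrite AN_energy// uF.
Qed.

Lemma RNP F : H1_dual Om F -> H1 (RN Om s F) /\
  forall v, H1 v -> energy_form s (RN Om s F) v = F v.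
Proof.
move=> /energy_representation[u uP].
have [Hr rP] : [set u | H1 u /\ forall v, H1 v -> AN Om s u v = F v] (RN Om s F).
  by apply: xgetPex; exists u.
by split=> // v Hv; rewrite -AN_energy// rP.
Qed.

End coercive.
End sobolev_space.
(** * Oscillating test functions *)
Section oscillation.
Context (R : realType) (n : nat).
Variable Om : set 'rV[R]_n.
Hypothesis oOm : open Om.

Local Notation mu := (@lebesgue_rV R n).
Local Notation S := (sq_integrable mu Om).
Local Notation l2_ip := (l2_ip mu Om).
Local Notation weighted_ip := (weighted_ip mu Om).
Local Notation bounded := (ess_bounded mu Om).

Let mOm : measurable Om := open_measurable_rV oOm.

Lemma elementary_test_H1 phi : elementary_test Om phi -> H1 Om phi.
Proof.
move=> ephi; have tphi := elementary_test_function ephi.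
apply: (@H1P _ _ _ oOm phi (fun i => partial i phi)) => [|i|i].
- exact: elementary_test_sq_integrable.
- exact: test_partial_sq_integrable.
- by apply: weak_partial_smooth => //; exact: test_function_smooth tphi.
Qed.

Lemma grad_form_test s phi : bounded s -> elementary_test Om phi ->
  grad_form Om s phi phi = \sum_i weighted_ip s (partial i phi) (partial i phi).
Proof.
move=> sb ephi; have tphi := elementary_test_function ephi.
have Hphi := elementary_test_H1 ephi; apply: eq_bigr => i _.
have ps := test_partial_sq_integrable oOm i tphi.
have ws := wpartial_sq_integrable oOm i Hphi.
have E : {ae mu, forall x, Om x -> wpartial Om phi i x = partial i phi x}.
  apply: wpartial_unique => //.
  by apply: weak_partial_smooth => //; exact: test_function_smooth tphi.
exact: (ae_eq_weighted_ip mOm sb ws ps ws ps E E).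
Qed.

Lemma sum_delta (i0 : 'I_n) (W : R) : \sum_i (i0 == i)%:R * W = W.
Proof.
rewrite (bigD1 i0)//= eqxx mul1r big1 ?addr0// => i.
by rewrite eq_sym => /negbTE ->; rewrite mul0r.
Qed.

(** The arithmetic of the limit: the terms are the gradient forms a, the Dirichlet
    integrals b and the squared norms d of the two waves, with e = l ^ - 2. *)
Lemma wave_estimate (a1 a2 b1 b2 d1 d2 G G1 I W K e p : R) :
  `|a1| <= K * (b1 + d1) -> `|a2| <= K * (b2 + d2) ->
  a1 + a2 = e * G + W -> b1 + b2 = e * G1 + I -> d1 + d2 = e * I ->
  0 <= e -> e <= p -> 0 <= G1 -> 0 <= I -> 0 <= K ->
  - ((`|G| + K * (G1 + I)) * p) <= K * I - `|W|.
Proof.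
move=> h1 h2 aE bE dE e0 ep G10 I0 K0.
have -> : W = a1 + a2 - e * G by rewrite aE; ring.
have t := ler_normB (a1 + a2) (e * G); rewrite normrM (ger0_norm e0) in t.
have t' := ler_normD a1 a2.
have s : K * (b1 + d1) + K * (b2 + d2) = K * I + e * (K * (G1 + I)).
  by rewrite -mulrDr addrACA bE dE; ring.
have k1 : e * `|G| <= p * `|G| by rewrite ler_wpM2r.
have k2 : e * (K * (G1 + I)) <= p * (K * (G1 + I)).
  by rewrite ler_wpM2r// mulr_ge0// addr_ge0.
move: h1 h2 t t' s k1 k2; lra.
Qed.

Section waves.
Variables (i0 : 'I_n) (phi : 'rV[R]_n -> R) (l : R).
Hypothesis ephi : elementary_test Om phi.
Hypothesis l0 : l != 0.

Definition cos_wave (x : 'rV[R]_n) : R := (l^-1 * cos (l * x 0 i0)) * phi x.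
Definition sin_wave (x : 'rV[R]_n) : R := (l^-1 * sin (l * x 0 i0)) * phi x.

Lemma cos_wave_test : elementary_test Om cos_wave.
Proof.
by apply: elementary_testMl => //; apply: elem_mul; [exact: elem_cst|exact: elem_cos].
Qed.

Lemma sin_wave_test : elementary_test Om sin_wave.
Proof.
by apply: elementary_testMl => //; apply: elem_mul; [exact: elem_cst|exact: elem_sin].
Qed.

Let wave_derive (f f' : R -> R) i x : (forall t : R, is_derive t 1 f (f' t)) ->
  partial i (fun y => (l^-1 * f (l * y 0 i0)) * phi y) x =
  l^-1 * f (l * x 0 i0) * partial i phi x + (i0 == i)%:R * f' (l * x 0 i0) * phi x.
Proof.
move=> df; have tphi := elementary_test_function ephi.
have dphi := smooth_is_derive i x (test_function_smooth tphi).
have := @is_derive_coord_affine R n f (f' (l * x 0 i0)) l 0 i0 i x.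
under eq_fun do rewrite addr0; rewrite addr0 => /(_ (df _)) dfl.
have dfc := is_deriveM (is_derive_cst (l^-1) x (delta_mx 0 i : 'rV[R]_n)) dfl.
have [_] := is_deriveM dfc dphi.
rewrite /partial => E; rewrite [LHS]E /GRing.scale/= !fctE.
by move: ('D_(delta_mx 0 i) phi x) => D; field.
Qed.

Lemma partial_cos_wave i x : partial i cos_wave x =
  l^-1 * cos (l * x 0 i0) * partial i phi x - (i0 == i)%:R * sin (l * x 0 i0) * phi x.
Proof.
rewrite (wave_derive i x (@is_derive_cos R)).
by rewrite mulrN mulNr.
Qed.

Lemma partial_sin_wave i x : partial i sin_wave x =
  l^-1 * sin (l * x 0 i0) * partial i phi x + (i0 == i)%:R * cos (l * x 0 i0) * phi x.
Proof. exact: (wave_derive i x (@is_derive_sin R)). Qed.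

(** The cross terms cancel between the two waves, and cos^2 + sin^2 = 1. *)
Lemma weighted_ip_waves s i : bounded s ->
  weighted_ip s (partial i cos_wave) (partial i cos_wave) +
  weighted_ip s (partial i sin_wave) (partial i sin_wave) =
  l ^- 2 * weighted_ip s (partial i phi) (partial i phi) + (i0 == i)%:R * weighted_ip s phi phi.
Proof.
move=> sb; have tphi := elementary_test_function ephi.
have tc := elementary_test_function cos_wave_test.
have ts := elementary_test_function sin_wave_test.
have ps := elementary_test_sq_integrable oOm ephi.
have dps := test_partial_sq_integrable oOm i tphi.
have dcs := test_partial_sq_integrable oOm i tc; have dss := test_partial_sq_integrable oOm i ts.
have I f : S f -> mu.-integrable Om (EFin \o (fun x => s x * (f x * f x))).
  by move=> fs; exact: weighted_ip_integrable.
rewrite /weighted_ip -!RintegralZl ?I// -!RintegralD ?I//; try exact/real_integrableZ/I.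
apply: eq_Rintegral => x _; rewrite partial_cos_wave partial_sin_wave.
have := cos2Dsin2 (l * x 0 i0); set c := cos _; set t := sin _ => ct.
move: (partial i phi x) (phi x) (s x) => p f w.
rewrite -!mulrDr.
have -> : (l^-1 * c * p - (i0 == i)%:R * t * f) *
    (l^-1 * c * p - (i0 == i)%:R * t * f) +
    (l^-1 * t * p + (i0 == i)%:R * c * f) *
    (l^-1 * t * p + (i0 == i)%:R * c * f) =
    (c ^+ 2 + t ^+ 2) * (l ^- 2 * (p * p) + (i0 == i)%:R * (f * f)).
  by case: (i0 == i) => /=; field.
rewrite ct mul1r mulrDr; congr (_ + _); rewrite mulrCA//.
Qed.

Lemma l2_ip_waves : l2_ip cos_wave cos_wave + l2_ip sin_wave sin_wave = l ^- 2 * l2_ip phi phi.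
Proof.
have ps := elementary_test_sq_integrable oOm ephi.
have cs := elementary_test_sq_integrable oOm cos_wave_test.
have ss := elementary_test_sq_integrable oOm sin_wave_test.
rewrite !l2_ipE -RintegralZl ?sq_integrableM// -RintegralD ?sq_integrableM//.
apply: eq_Rintegral => x _; rewrite /cos_wave /sin_wave.
have ct := cos2Dsin2 (l * x 0 i0).
rewrite -[RHS]mul1r -ct; move: (phi x) => p; field => //.
Qed.

Lemma grad_form_waves s : bounded s ->
  grad_form Om s cos_wave cos_wave + grad_form Om s sin_wave sin_wave =
  l ^- 2 * grad_form Om s phi phi + weighted_ip s phi phi.
Proof.
move=> sb; rewrite !grad_form_test//; [|exact: sin_wave_test|exact: cos_wave_test].
rewrite -[in RHS](sum_delta i0 (weighted_ip s phi phi)) mulr_sumr -!big_split.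
by apply: eq_bigr => i _; exact: weighted_ip_waves.
Qed.

End waves.

(** With l = 2 ^ k and k tending to infinity, the bounds for the two waves add up
    to |int s phi ^ 2| <= K int phi ^ 2, for every test function phi. *)
Lemma grad_form_bound_ae s (K : R) (i0 : 'I_n) : bounded s -> 0 <= K ->
  (forall u, H1 Om u -> `|grad_form Om s u u| <= K * energy_form Om (cst 1) u u) ->
  {ae mu, forall x, Om x -> `|s x| <= K}.
Proof.
move=> sb K0 sK; have b1 := ess_bounded_cst mu Om 1.
have bK := ess_bounded_cst mu Om K.
have key phi : elementary_test Om phi -> `|weighted_ip s phi phi| <= K * l2_ip phi phi.
  move=> ephi.
  rewrite -subr_ge0; set G := grad_form Om s phi phi; set G1 := grad_form Om (cst 1) phi phi.
  apply: (@ge0_of_geom _ _ (`|G| + K * (G1 + l2_ip phi phi))) => k.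
  pose l : R := 2 ^+ k; have l0 : l != 0 by rewrite expf_neq0.
  have ec := cos_wave_test i0 l ephi; have es := sin_wave_test i0 l ephi.
  have hc := sK _ (elementary_test_H1 ec).
  have hs := sK _ (elementary_test_H1 es).
  have gs := grad_form_waves i0 ephi l0 sb.
  have g1 := grad_form_waves i0 ephi l0 b1.
  have ii := l2_ip_waves i0 ephi l0.
  have l2 : l ^- 2 <= 2^-1 ^+ k.
    rewrite /l -exprM exprVn lef_pV2 ?posrE ?exprn_gt0//.
    by rewrite ler_eXn2l ?ltr1n// leq_pmulr.
  have l20 : 0 <= l ^- 2 by rewrite invr_ge0 exprn_ge0// exprn_ge0.
  have G10 : 0 <= G1 := grad_form1_ge0 Om phi.
  have I0 : 0 <= l2_ip phi phi := l2_ip_ge0 mu Om phi.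
  exact: (wave_estimate hc hs gs g1 ii l20 l2 G10 I0 K0).
have sP : {ae mu, forall x, Om x -> 0 <= K - s x}.
  apply: (weighted_ip_ge0_ae oOm) => [|phi ephi]; first exact: ess_boundedB.
  have ps := elementary_test_sq_integrable oOm ephi.
  rewrite (weighted_ipB mOm bK sb ps ps) subr_ge0.
  rewrite (le_trans (ler_norm _))// (le_trans (key _ ephi))//.
  rewrite -(weighted_ipZ mOm K b1 ps ps) le_eqVlt; apply/orP; left; apply/eqP.
  by congr (weighted_ip _ _ _); apply/funext => x; rewrite mulr1.
have sN : {ae mu, forall x, Om x -> 0 <= s x - (- K)}.
  have bNK := ess_bounded_cst mu Om (- K).
  apply: (weighted_ip_ge0_ae oOm) => [|phi ephi]; first exact: ess_boundedB.
  have ps := elementary_test_sq_integrable oOm ephi.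
  rewrite (weighted_ipB mOm sb bNK ps ps) subr_ge0.
  have := key _ ephi; rewrite ler_norml => /andP[h _]; rewrite (le_trans _ h)//.
  rewrite -mulNr -(weighted_ipZ mOm (- K) b1 ps ps) le_eqVlt; apply/orP; left; apply/eqP.
  by congr (weighted_ip _ _ _); apply/funext => x; rewrite mulr1.
apply: filterS2 sP sN => x sP sN Ox; rewrite ler_norml.
by move: (sP Ox) (sN Ox) => h1 h2; apply/andP; split; lra.
Qed.

End oscillation.
(** * Operator norms *)
Section operator_norms.
Context (R : realType) (n : nat).
Variable Om : set 'rV[R]_n.
Hypothesis oOm : open Om.

Local Notation mu := (@lebesgue_rV R n).
Local Notation H1 := (H1 Om).
Local Notation N := (H1_norm Om).
Local Notation energy := (energy_form Om).
Local Notation bounded := (ess_bounded mu Om).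

Let mOm : measurable Om := open_measurable_rV oOm.
Let Hsub := subspace_H1 oOm.
Let b1 : bounded (cst 1) := ess_bounded_cst mu Om 1.
Let eS := symmetric_energy_form oOm b1.
Let e0 u (_ : H1 u) := energy1_ge0 Om u.

Lemma H1_norm_ge0 u : 0 <= N u. Proof. exact: sqrtr_ge0. Qed.

Lemma H1_norm_sqr u : H1 u -> N u ^+ 2 = energy (cst 1) u u.
Proof. by move=> Hu; rewrite H1_normE// sqr_sqrtr// energy1_ge0. Qed.

Lemma H1_normZ a u : H1 u -> N (a *: u) = `|a| * N u.
Proof.
move=> Hu; rewrite !H1_normE//; last exact: subspaceZ.
by rewrite (form_sqrZ Hsub eS)// sqrtrM ?sqr_ge0// sqrtr_sqr.
Qed.

(** By scaling; where the norm of [v] vanishes, boundedness of [F] gives F v = 0. *)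
Lemma H1_dual_le F v : H1_dual Om F -> (H1_dual_norm Om F <= 1)%E -> H1 v ->
  `|F v| <= N v.
Proof.
move=> [FL [C FC]] F1 Hv; have := H1_norm_ge0 v; rewrite le_eqVlt => /predU1P[v0|v0].
  by rewrite -v0 (le_trans (FC v Hv))// -v0 mulr0.
have Hw := subspaceZ Hsub (N v)^-1 Hv.
have : (`|F ((N v)^-1 *: v)|%:E <= 1)%E.
  apply: le_trans F1; apply: ereal_sup_ubound; exists ((N v)^-1 *: v) => //; split=> //.
  by rewrite /= H1_normZ// gtr0_norm ?invr_gt0// mulVf ?gt_eqF.
rewrite lee_fin (lformZ Hsub FL)// normrM gtr0_norm ?invr_gt0//.
by rewrite ler_pdivrMl// mulr1.
Qed.

Lemma H1_dual_unit F : linear_form_on H1 F -> (forall v, H1 v -> `|F v| <= N v) ->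
  H1_dual Om F /\ (H1_dual_norm Om F <= 1)%E.
Proof.
move=> FL FN; split; first by split=> //; exists 1 => u Hu; rewrite mul1r FN.
apply: ge_ereal_sup => _ [u [Hu u1] <-]; rewrite lee_fin.
by rewrite (le_trans _ u1)// FN.
Qed.

Lemma grad_form_cs s (T : R) u v : bounded s -> 0 <= T ->
  {ae mu, forall x, Om x -> `|s x| <= T} -> H1 u -> H1 v ->
  `|grad_form Om s u v| <= T * (N u * N v).
Proof.
move=> sb T0 sT Hu Hv; rewrite !H1_normE//.
apply: (form_dominated Hsub (symmetric_grad_form oOm sb) eS) => // w Hw.
exact: grad_form_bound.
Qed.

Lemma Linfty_le (f : 'rV[R]_n -> R) (c : R) : 0 <= c ->
  {ae mu, forall x, Om x -> `|f x| <= c} -> (Lp_norm Om +oo%E f <= c%:E)%E.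
Proof.
move=> c0 fc; rewrite /Lp_norm unlock; case: ifP => // _.
apply/ess_supP; apply: filterS fc => x fc /=; rewrite lee_fin patchE.
by case: ifPn => [/set_mem/fc//|_]; rewrite normr0.
Qed.

Lemma Linfty_ae (f : 'rV[R]_n -> R) (c : R) : Lp_norm Om +oo%E f = c%:E ->
  {ae mu, forall x, Om x -> `|f x| <= c}.
Proof.
rewrite /Lp_norm unlock; case: ifPn => [_ fc|]; last first.
  rewrite -leNgt measure_le0 => /eqP mu0 _.
  by exists setT; split.
have := ess_sup_ge mu (abse \o (EFin \o f \_ Om)); rewrite fc.
apply: filterS => x; rewrite /= lee_fin patchE => + Ox.
by rewrite mem_set.
Qed.

Lemma SigmaP s0 s1 s : Sigma Om s0 s1 s ->
  bounded s /\ {ae mu, forall x, Om x -> s0 <= s x <= s1}.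
Proof.
move=> [/andP[ms _] ss]; split=> //; split.
  by apply/(measurable_restrictT _ mOm); move: ms; rewrite inE.
exists (`|s0| + `|s1|); apply: filterS ss => x /[apply] /andP[h0 h1].
rewrite ler_norml; apply/andP; split.
  by have := ler_norm (- s0); rewrite normrN; move: (normr_ge0 s1); lra.
by have := ler_norm s1; move: (normr_ge0 s0); lra.
Qed.

Lemma energy_cs (s0 s1 : R) s u v : 0 < s0 -> bounded s ->
  {ae mu, forall x, Om x -> s0 <= s x <= s1} -> H1 u -> H1 v ->
  `|energy s u v| <= Num.max s1 1 * (N u * N v).
Proof.
move=> s00 sb ss Hu Hv; rewrite !H1_normE//.
apply: (form_dominated Hsub (symmetric_energy_form oOm sb) eS) => // [|w Hw].
  by rewrite le_max ler01 orbT.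
rewrite ger0_norm; first exact: (energy_bounded oOm sb ss Hw).
exact: (energy_ge0 oOm sb s00 ss Hw).
Qed.

Section coefficient.
Variables (s0 s1 : R) (s t : 'rV[R]_n -> R).
Hypothesis s00 : 0 < s0.
Hypotheses (sb : bounded s) (ss : {ae mu, forall x, Om x -> s0 <= s x <= s1}).
Hypotheses (tb : bounded t) (ts : {ae mu, forall x, Om x -> s0 <= t x <= s1}).

Let m0 := Num.min s0 1.
Let m1 := Num.max s1 1.
Let m00 : 0 < m0. Proof. by rewrite lt_min s00 ltr01. Qed.
Let m10 : 0 < m1. Proof. by rewrite lt_max ltr01 orbT. Qed.
Let stb : bounded (fun x => s x - t x). Proof. exact: ess_boundedB. Qed.


(** The resolvent identity: both resolvents solve their equation with the same
    right-hand side [F]. *)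
Lemma RN_difference F v : H1_dual Om F -> H1 v ->
  energy s (RN Om s F - RN Om t F) v =
  - grad_form Om (fun x => s x - t x) (RN Om t F) v.
Proof.
move=> dF Hv; have [Hu uF] := RNP oOm sb s00 ss dF.
have [Hw wF] := RNP oOm tb s00 ts dF.
rewrite (formBl Hsub (symmetric_energy_form oOm sb) Hu Hw Hv) uF// -(wF v Hv).
by rewrite /energy_form grad_formB//; ring.
Qed.

(** With w the second solution and d the difference, coercivity yields
    m0 |d| ^ 2 <= T |w| |d| and m0 |w| ^ 2 <= F w <= |w|. *)
Lemma RN_difference_norm (T : R) F : 0 <= T ->
  {ae mu, forall x, Om x -> `|s x - t x| <= T} ->
  H1_dual Om F -> (H1_dual_norm Om F <= 1)%E ->
  N (RN Om s F - RN Om t F) <= T / m0 ^+ 2.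
Proof.
move=> T0 stT dF F1; have [Hu uF] := RNP oOm sb s00 ss dF.
have [Hw wF] := RNP oOm tb s00 ts dF.
have Hd := subspaceB Hsub Hu Hw.
set u := RN Om s F in Hu Hd *; set w := RN Om t F in Hw wF Hd *.
have hd : m0 * N (u - w) ^+ 2 <= T * (N w * N (u - w)).
  rewrite H1_norm_sqr// (le_trans (energy_coercive oOm sb ss Hd))//.
  rewrite RN_difference// (le_trans (ler_norm _))// normrN.
  exact: grad_form_cs.
have hw : m0 * N w ^+ 2 <= N w.
  rewrite H1_norm_sqr// (le_trans (energy_coercive oOm tb ts Hw))// wF//.
  by rewrite (le_trans (ler_norm _))// H1_dual_le.
have hw' : m0 * N w <= 1.
  have := H1_norm_ge0 w; rewrite le_eqVlt => /predU1P[<-|w0]; first by rewrite mulr0.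
  by rewrite -(ler_pM2r w0) mul1r -mulrA -expr2.
have hd' : m0 * N (u - w) <= T * N w.
  have := H1_norm_ge0 (u - w); rewrite le_eqVlt => /predU1P[<-|d0].
    by rewrite mulr0 mulr_ge0// H1_norm_ge0.
  by rewrite -(ler_pM2r d0) -!mulrA -expr2.
rewrite ler_pdivlMr ?exprn_gt0// mulrC expr2 -mulrA.
rewrite (le_trans (ler_wpM2l (ltW m00) hd'))// mulrCA -[leRHS]mulr1.
by rewrite ler_wpM2l.
Qed.

(** Take F = A' v, where v is u scaled so that F has norm at most 1.  The second
    resolvent of F differs from v only by an element of norm 0. *)
Lemma grad_form_RN_bound (K : R) u : 0 <= K ->
  (forall F, H1_dual Om F -> (H1_dual_norm Om F <= 1)%E ->
    N (RN Om s F - RN Om t F) <= K) ->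
  H1 u -> `|grad_form Om (fun x => s x - t x) u u| <=
    m1 ^+ 2 * K * energy (cst 1) u u.
Proof.
move=> K0 dK Hu; have [_ [C0 stC0]] := stb.
pose C : R := `|C0|; have C00 : 0 <= C by exact: normr_ge0.
have stC : {ae mu, forall x, Om x -> `|s x - t x| <= C}.
  by apply: filterS stC0 => x /[apply] h; rewrite (le_trans h)// ler_norm.
rewrite -H1_norm_sqr//.
have := H1_norm_ge0 u; rewrite le_eqVlt => /predU1P[u0|u0].
  by rewrite (le_trans (grad_form_cs stb C00 stC Hu Hu))// -u0 expr0n !mul0r !mulr0.
have tS := symmetric_energy_form oOm tb.
pose r := (m1 * N u)^-1; have r0 : 0 < r by rewrite invr_gt0 mulr_gt0.
pose v := r *: u; have Hv : H1 v := subspaceZ Hsub r Hu.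
have Nv : N v = m1^-1.
  rewrite /v H1_normZ// gtr0_norm// /r; field.
  by rewrite !gt_eqF.
pose F w := energy t v w.
have FL : linear_form_on H1 F.
  move=> a x y Hx Hy; rewrite /F !(formC tS Hv)//; last exact: Hsub.2.
  exact: (tS.2 v Hv).
have [|dF F1] := @H1_dual_unit F FL.
  move=> w Hw; rewrite (le_trans (energy_cs s00 tb ts Hv Hw))// Nv mulrA.
  by rewrite divff ?gt_eqF// mul1r.
have [Hu1 u1F] := RNP oOm sb s00 ss dF.
have [Hu2 u2F] := RNP oOm tb s00 ts dF.
have RB w : H1 w -> _ := RN_difference dF.
have dFK := dK F dF F1.
set u1 := RN Om s F in Hu1 u1F RB dFK; set u2 := RN Om t F in Hu2 u2F RB dFK.
have Hu2v := subspaceB Hsub Hu2 Hv.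
have Nu2v : N (u2 - v) = 0.
  apply/eqP; rewrite -sqrf_eq0 eq_le sqr_ge0 andbT -(ler_pM2l m00) mulr0.
  rewrite H1_norm_sqr// (le_trans (energy_coercive oOm tb ts Hu2v))//.
  by rewrite (formBl Hsub tS Hu2 Hv Hu2v) u2F// subrr.
have gS := symmetric_grad_form oOm stb.
have g0 : grad_form Om (fun x => s x - t x) (u2 - v) v = 0.
  apply/eqP; rewrite -normr_eq0 eq_le normr_ge0 andbT.
  by rewrite (le_trans (grad_form_cs stb C00 stC Hu2v Hv))// Nu2v mul0r mulr0.
have gv : `|grad_form Om (fun x => s x - t x) v v| <= K.
  have -> : grad_form Om (fun x => s x - t x) v v =
      grad_form Om (fun x => s x - t x) u2 v.
    by apply/eqP; rewrite eq_sym -subr_eq0 -(formBl Hsub gS Hu2 Hv Hv) g0.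
  rewrite -normrN -RB//.
  rewrite (le_trans (energy_cs s00 sb ss (subspaceB Hsub Hu1 Hu2) Hv))// Nv.
  by rewrite mulrC -mulrA mulVf ?gt_eqF// mulr1.
move: gv; rewrite /v (form_sqrZ Hsub gS)// normrM ger0_norm ?sqr_ge0//.
rewrite mulrC -ler_pdivlMr ?exprn_gt0// => h; rewrite (le_trans h)//.
rewrite le_eqVlt /r -exprVn invrK exprMn mulrCA mulrA.
by apply/orP; left.
Qed.

End coefficient.
End operator_norms.
Theorem mainTheorem2 (R : realType) (n : nat) (Om : set 'rV[R]_n)
    (s0 s1 : R) (sigma sigma' : 'rV[R]_n -> R) :
  (1 <= n)%N -> domain Om -> bounded_set Om -> 0 < s0 -> s0 < s1 ->
  Sigma Om s0 s1 sigma -> Sigma Om s0 s1 sigma' ->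
  let m0 := Num.min s0 1 in
  let m1 := Num.max s1 1 in
  let dR := norm_m1_1 Om (fun F => RN Om sigma F - RN Om sigma' F) in
  let dsigma := Lp_norm Om +oo%E (sigma - sigma') in
  ((m0 ^+ 2)%:E * dR <= dsigma /\ dsigma <= (m1 ^+ 2)%:E * dR)%E.
Proof.
move=> n1 [oOm _ _] _ s00 _ sS sS' m0 m1 dR dsigma.
have [sb ss] := SigmaP oOm sS; have [sb' ss'] := SigmaP oOm sS'.
have m00 : 0 < m0 by rewrite lt_min s00 ltr01.
have [_ [C stC]] := ess_boundedB sb sb'.
have dsfin : dsigma \is a fin_num.
  rewrite ge0_fin_numE ?Lnorm_ge0//; apply: le_lt_trans (ltry `|C|).
  apply: Linfty_le => //; apply: filterS stC => x /[apply] h.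
  by rewrite (le_trans h)// ler_norm.
pose T := fine dsigma; have dsE : dsigma = T%:E by rewrite fineK.
have T0 : 0 <= T by rewrite fine_ge0// Lnorm_ge0.
have dsT := Linfty_ae dsE.
have dRT : (dR <= (T / m0 ^+ 2)%:E)%E.
  apply: ge_ereal_sup => _ [F [dF F1] <-]; rewrite lee_fin.
  exact: (RN_difference_norm oOm s00 sb ss sb' ss' T0 dsT dF F1).
split.
  have m02 : 0 < m0 ^+ 2 by rewrite exprn_gt0.
  rewrite dsE (@le_trans _ _ ((m0 ^+ 2)%:E * (T / m0 ^+ 2)%:E)%E)//.
    by rewrite lee_wpmul2l// lee_fin ltW.
  by rewrite -EFinM lee_fin mulrCA mulfV ?mulr1// gt_eqF.
have dR0 : (0 <= dR)%E.
  pose F0 : ('rV[R]_n -> R) -> R := fun=> 0.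
  have [dF F1] : H1_dual Om F0 /\ (H1_dual_norm Om F0 <= 1)%E.
    apply: H1_dual_unit => [a u v _ _|v _]; first by rewrite /F0 mulr0 addr0.
    by rewrite normr0 H1_norm_ge0.
  apply: (@le_trans _ _ (H1_norm Om (RN Om sigma F0 - RN Om sigma' F0))%:E).
    by rewrite lee_fin H1_norm_ge0.
  by apply: ereal_sup_ubound; exists F0.
have dRfin : dR \is a fin_num.
  by rewrite ge0_fin_numE//; apply: le_lt_trans dRT (ltry _).
pose K := fine dR; have dRE : dR = K%:E by rewrite fineK.
have K0 : 0 <= K by rewrite fine_ge0.
have dRK F : H1_dual Om F -> (H1_dual_norm Om F <= 1)%E ->
    H1_norm Om (RN Om sigma F - RN Om sigma' F) <= K.
  by move=> dF F1; rewrite -lee_fin -dRE; apply: ereal_sup_ubound; exists F.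
have K1 : 0 <= m1 ^+ 2 * K by rewrite mulr_ge0// exprn_ge0// le_max ler01 orbT.
rewrite dRE -EFinM; apply: Linfty_le => //.
apply: (grad_form_bound_ae oOm (Ordinal n1)) => // [|u Hu]; first exact: ess_boundedB.
exact: (grad_form_RN_bound oOm s00 sb ss sb' ss' K0 dRK Hu).
Qed.
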